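(* Let $m=1$ and $p=N$. Let $\mathcal{X}$ be an admissible function space such that for any $u\in\mathcal{X}$ and any $t\ge0$, $s\le0$, one has $\min(u,t)\in\mathcal{X}$ and $\max(u,s)\in\mathcal{X}$. Consider the problems $(\mathcal{P}_0')$: minimize $J(v)$ in the set $\{v\in\mathcal{X}\;|\;v\neq0,\ V(v)=0\}$; $(\mathcal{P}_0'')$: minimize $J(v)$ in the set $\{v\in\mathcal{X}\;|\;v\neq0,\ V(v)\ge0\}$; $(\mathcal{P}_0''')$: minimize $J(v)$ in the set $\{v\in\mathcal{X}\;|\;v\neq0,\ V(v)\le0\}$. Assume that $T_0:=\inf\{J(u)\;|\;u\in\mathcal{X},\ u\neq0,\ V(u)=0\}>0$ and that $(\mathcal{P}_0')$ admits a minimizer. Then: (a) if $G<0$ on $[-\varepsilon,0)\cup(0,\varepsilon]$ for some $\varepsilon>0$, then $u\in\mathcal{X}$ is a minimizer of $(\mathcal{P}_0')$ if and only if it is a minimizer of $(\mathcal{P}_0'')$; (b) if $G>0$ on $[-\varepsilon,0)\cup(0,\varepsilon]$ for some $\varepsilon>0$, then $u\in\mathcal{X}$ is a minimizer of $(\mathcal{P}_0')$ if and only if it is a minimizer of $(\mathcal{P}_0''')$. Moreover, any minimizer of $(\mathcal{P}_0'')$ (in case (a)) or of $(\mathcal{P}_0''')$ (in case (b)) does not change sign.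
   Context: Setting (scalar case): $1<p<\infty$, $g:\mathbf{R}\to\mathbf{R}$ with $g(0)=0$, and there is $G\in C^1(\mathbf{R}\setminus\{0\},\mathbf{R})\cap C(\mathbf{R},\mathbf{R})$ such that $g(s)=G'(s)$ for $s\ne0$. Functions $u$ are real-valued on $\mathbf{R}^N$; gradients are weak gradients. Notation: for $\sigma>0$, $f_\sigma(x)=f(x/\sigma)$. For an affine hyperplane $\Pi$ in $\mathbf{R}^N$, $\Pi^+$ and $\Pi^-$ are the two closed half-spaces determined by $\Pi$ and $s_\Pi$ is the reflection in $\Pi$; for $f$ defined on $\mathbf{R}^N$, $f_{\Pi^+}(x)=f(x)$ if $x\in\Pi^+$ and $f(s_\Pi(x))$ if $x\in\Pi^-$; $f_{\Pi^-}(x)=f(x)$ if $x\in\Pi^-$ and $f(s_\Pi(x))$ if $x\in\Pi^+$. A space $\mathcal{X}$ of functions on $\mathbf{R}^N$ is admissible if it is nonempty and: (i) $\mathcal{X}\subset L^1_{loc}(\mathbf{R}^N,\mathbf{R})$ and $\{x\;|\;|u(x)|>\alpha\}$ has finite measure for all $u\in\mathcal{X}$, $\alpha>0$; (ii) $g(u)\in L^1_{loc}(\mathbf{R}^N)$ for all $u\in\mathcal{X}$; (iii) $|\nabla u|^p$ and $G(u)$ belong to $L^1(\mathbf{R}^N)$ for all $u\in\mathcal{X}$; (iv) $u_\sigma\in\mathcal{X}$ for all $u\in\mathcal{X}$, $\sigma>0$; (v) $u_{\Pi^+},u_{\Pi^-}\in\mathcal{X}$ for all $u\in\mathcal{X}$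 and all affine hyperplanes $\Pi$ in $\mathbf{R}^N$. Functionals on $\mathcal{X}$: $J(u)=\frac1p\int_{\mathbf{R}^N}|\nabla u|^p\,dx$ and $V(u)=\int_{\mathbf{R}^N}G(u)\,dx$. ''$u$ does not change sign'' means that $u\ge0$ a.e. or $u\le0$ a.e. on $\mathbf{R}^N$. *)

(* Defs.v *)
From HB Require Import structures.
From mathcomp Require Import all_boot all_order all_algebra.
From mathcomp Require Import all_classical all_reals all_analysis.

Set Implicit Arguments.
Unset Strict Implicit.
Unset Printing Implicit Defensive.

Import Order.TTheory GRing.Theory Num.Theory.
Import numFieldNormedType.Exports.

Local Open Scope classical_set_scope.
Local Open Scope ring_scope.

Fact rV_display : measure_display. Proof. exact: default_measure_display. Qed.

(* R^n is 'rV[R]_n with the sigma-algebra generated by the coordinates, i.e.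
   the Borel one, as the library does for n.-tuple. *)
Section measurable_rV.
Context {R : realType} (n : nat).

Definition rV_coord (i : 'I_n) (v : 'rV[R]_n) : measurableTypeR R := v ord0 i.

Let rV_set0 : g_sigma_preimage rV_coord set0.
Proof. exact: sigma_algebra0. Qed.

Let rV_setC A : g_sigma_preimage rV_coord A ->
  g_sigma_preimage rV_coord (~` A).
Proof. exact: sigma_algebraC. Qed.

Let rV_bigcup (F : _^nat) : (forall i, g_sigma_preimage rV_coord (F i)) ->
  g_sigma_preimage rV_coord (\bigcup_i (F i)).
Proof. exact: sigma_algebra_bigcup. Qed.

HB.instance Definition _ := @isMeasurable.Build rV_display
  'rV[R]_n (g_sigma_preimage rV_coord) rV_set0 rV_setC rV_bigcup.

Lemma measurable_rV_coord (i : 'I_n) : measurable_fun [set: 'rV[R]_n] (rV_coord i).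
Proof.
move=> _ Y mY; rewrite setTI; apply: sub_sigma_algebra => /=.
rewrite -bigcup_seq/=; exists i => /=; first by rewrite mem_index_enum.
by exists Y => //; rewrite setTI.
Qed.

Lemma measurable_fun_rVP d (T : measurableType d) (f : T -> 'rV[R]_n) :
  measurable_fun [set: T] f <->
  forall i, measurable_fun [set: T] (rV_coord i \o f).
Proof.
split=> [mf i|mf]; first exact: measurableT_comp (measurable_rV_coord i) mf.
move=> _ A mA; rewrite setTI; move: A mA.
suff : g_sigma_preimage rV_coord `<=` [set A | measurable (f @^-1` A)] by [].
apply: smallest_sub.
  split => /=; first by rewrite preimage_set0.
  - by move=> A mA; rewrite setTD preimage_setC; exact: measurableC.
  - by move=> F mF; rewrite preimage_bigcup; exact: bigcupT_measurable.
rewrite -bigcup_seq; apply: bigcup_sub => i _ A [B mB <-] /=.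
by rewrite setTI -comp_preimage -[X in measurable X]setTI; exact: mf.
Qed.

End measurable_rV.

Section lebesgue_rV.
Context {R : realType}.

Definition rV_cons n (xv : measurableTypeR R * 'rV[R]_n) : 'rV[R]_n.+1 :=
  row_mx (xv.1 : R)%:M xv.2.

Lemma rV_cons0 n xv : @rV_cons n xv ord0 ord0 = xv.1.
Proof.
rewrite /rV_cons (_ : ord0 = lshift n (ord0 : 'I_1)); last exact: val_inj.
by rewrite [LHS]row_mxEl mxE eqxx mulr1n.
Qed.

Lemma rV_consS n xv i : @rV_cons n xv ord0 (lift ord0 i) = xv.2 ord0 i.
Proof.
rewrite /rV_cons (_ : lift _ _ = rshift 1 i); last exact: val_inj.
by rewrite [LHS]row_mxEr.
Qed.

Lemma measurable_rV_cons n : measurable_fun setT (@rV_cons n).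
Proof.
apply/measurable_fun_rVP => i; have [j ->|->] := unliftP ord0 i.
- rewrite (_ : _ \o _ = rV_coord j \o snd).
    exact: measurableT_comp (measurable_rV_coord j) measurable_snd.
  by apply/funext => x; exact: rV_consS.
- by rewrite (_ : _ \o _ = fst)//; apply/funext => x; exact: rV_cons0.
Qed.

Section step.
Variables (n : nat) (m : {sigma_finite_measure set 'rV[R]_n -> \bar R}).

Definition lebesgue_rV_step : set 'rV[R]_n.+1 -> \bar R :=
  pushforward (@lebesgue_measure R \x m)%E (@rV_cons n).

HB.instance Definition _ := Measure.copy lebesgue_rV_step
  (measure_function_pushforward__canonical__measure_function_Measure
    (@lebesgue_measure R \x m)%E (@measurable_rV_cons n)).

Let lebesgue_rV_step_sigma_finite : sigma_finite setT lebesgue_rV_step.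
Proof.
pose hd (v : 'rV[R]_n.+1) := rV_coord ord0 v.
pose tl (v : 'rV[R]_n.+1) : 'rV[R]_n := \row_i v ord0 (lift ord0 i).
have consK x : (hd (rV_cons x), tl (rV_cons x)) = x.
  rewrite {3}(surjective_pairing x) /hd /rV_coord rV_cons0; congr pair.
  by apply/rowP => i; rewrite mxE rV_consS.
have mhd : measurable_fun setT hd by exact: measurable_rV_coord.
have mtl : measurable_fun setT tl.
  apply/measurable_fun_rVP => i.
  rewrite (_ : _ \o _ = rV_coord (lift ord0 i)); last first.
    by apply/funext => v; rewrite /= /rV_coord mxE.
  exact: measurable_rV_coord.
have /sigma_finiteP[F [FT ndF Foo]] := sigma_finiteT (@lebesgue_measure R).
have /sigma_finiteP[G [GT ndG Goo]] := sigma_finiteT m.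
pose unc v := (hd v, tl v).
have munc : measurable_fun setT unc by exact: measurable_fun_pair.
exists (fun k => unc @^-1` (F k `*` G k)).
  apply/seteqP; split => // v _.
  have [i _ Fi] : (\bigcup_i F i) (hd v) by rewrite -FT.
  have [j _ Gj] : (\bigcup_j G j) (tl v) by rewrite -GT.
  exists (maxn i j) => //; split => /=.
  - by move: Fi; exact/subsetPset/ndF/leq_maxl.
  - by move: Gj; exact/subsetPset/ndG/leq_maxr.
move=> k; have [[mF Fk] [mG Gk]] := (Foo k, Goo k).
have mFG : measurable (F k `*` G k) by exact: measurableX.
split; first by rewrite -[X in measurable X]setTI; exact: munc.
rewrite /lebesgue_rV_step /pushforward -comp_preimage.
rewrite (_ : unc \o _ = id); last by apply/funext => x; exact: consK.
by rewrite preimage_id product_measure1E// lte_mul_pinfty// ge0_fin_numE.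
Qed.

HB.instance Definition _ := Measure_isSigmaFinite.Build _ _ _
  lebesgue_rV_step lebesgue_rV_step_sigma_finite.

End step.

Fixpoint lebesgue_rV n : {sigma_finite_measure set 'rV[R]_n -> \bar R} :=
  match n with
  | 0 => \d_(0 : 'rV[R]_0)
  | n'.+1 => lebesgue_rV_step (lebesgue_rV n')
  end.

Lemma lebesgue_rV_box n (A : 'I_n -> set (measurableTypeR R)) :
  (forall i, measurable (A i)) ->
  lebesgue_rV n [set v | forall i, A i (v ord0 i)] =
  (\prod_(i < n) lebesgue_measure (A i))%E.
Proof.
elim: n A => [|n IHn] A mA.
  rewrite big_ord0 /= diracE mem_set//.
  by case.
rewrite big_ord_recl -IHn; last by move=> i; exact: mA.
rewrite /= /lebesgue_rV_step /pushforward.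
rewrite -product_measure1E; [|exact: mA|].
- congr ((_ \x _)%E _); apply/seteqP; split => [x /= h|x /= [h0 hS] i].
  + by split=> [|i]; [rewrite -rV_cons0|rewrite -rV_consS]; exact: h.
  + by have [j ->|->] := unliftP ord0 i; rewrite ?rV_consS ?rV_cons0.
- have -> : (fun v : 'rV[R]_n => forall i, A (lift ord0 i) (v ord0 i)) =
      \bigcap_(i in [set: 'I_n]) (rV_coord i @^-1` A (lift ord0 i)).
    by apply/seteqP; split => [x /= h i _|x /= h i]; [exact: h|exact: (h i I)].
  apply: fin_bigcap_measurable => // i _; rewrite -[X in measurable X]setTI.
  exact: measurable_rV_coord.
Qed.

End lebesgue_rV.

Section calculus_rV.
Context {R : realType} {n : nat}.
Implicit Types (u phi : 'rV[R]_n -> R) (x y : 'rV[R]_n).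

Definition dotv x y : R := \sum_(i < n) x ord0 i * y ord0 i.

(* The norm of the library on 'rV[R]_n is the sup norm. *)
Definition enorm x : R := Num.sqrt (dotv x x).

Definition basisv (i : 'I_n) : 'rV[R]_n := delta_mx ord0 i.

Definition iter_partial (s : seq 'I_n) (f : 'rV[R]_n -> R) : 'rV[R]_n -> R :=
  foldr (fun i h => 'D_(basisv i) h) f s.

Definition smooth (f : 'rV[R]_n -> R) : Prop :=
  forall s : seq 'I_n, continuous (iter_partial s f) /\
    forall i x, derivable (iter_partial s f) x (basisv i).

Definition test_function phi : Prop :=
  smooth phi /\ compact (closure [set x | phi x != 0]).

Definition locally_integrable_rV u : Prop :=
  measurable_fun [set: 'rV[R]_n] u /\
  forall K : set 'rV[R]_n, compact K ->
    (\int[lebesgue_rV n]_(x in K) `|u x|%:E < +oo)%E.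

Definition is_weak_gradient u (w : 'rV[R]_n -> 'rV[R]_n) : Prop :=
  forall i : 'I_n, locally_integrable_rV (fun x => w x ord0 i) /\
    forall phi, test_function phi ->
      (\int[lebesgue_rV n]_x (u x * 'D_(basisv i) phi x)%:E =
       - \int[lebesgue_rV n]_x (w x ord0 i * phi x)%:E)%E.

Definition weakly_differentiable u : Prop := exists w, is_weak_gradient u w.

(* The weak gradient is unique up to a null set; an arbitrary representative is
   chosen. The value 0 taken when there is none is junk. *)
Definition weak_gradient u : 'rV[R]_n -> 'rV[R]_n :=
  xget (fun=> 0) [set w | is_weak_gradient u w].

Definition dilate (sigma : R) u : 'rV[R]_n -> R := fun x => u (sigma^-1 *: x).

(* An affine hyperplane is {x | dotv a x = c} with a != 0; its closed
   half-spaces are {x | c <= dotv a x} and {x | dotv a x <= c}. *)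
Definition reflect_hyp (a : 'rV[R]_n) (c : R) x : 'rV[R]_n :=
  x - (2 * (dotv a x - c) / dotv a a) *: a.

Definition fold_pos (a : 'rV[R]_n) (c : R) u : 'rV[R]_n -> R :=
  fun x => if c <= dotv a x then u x else u (reflect_hyp a c x).

Definition fold_neg (a : 'rV[R]_n) (c : R) u : 'rV[R]_n -> R :=
  fun x => if dotv a x <= c then u x else u (reflect_hyp a c x).

Definition nonzero_ae u : Prop := ~ {ae lebesgue_rV n, forall x, u x = 0}.

Definition no_sign_change u : Prop :=
  {ae lebesgue_rV n, forall x, 0 <= u x} \/
  {ae lebesgue_rV n, forall x, u x <= 0}.

Definition Jfun (p : R) u : \bar R :=
  ((p^-1)%:E * \int[lebesgue_rV n]_x (enorm (weak_gradient u x) `^ p)%:E)%E.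

Definition Vfun (G : R -> R) u : \bar R :=
  (\int[lebesgue_rV n]_x (G (u x))%:E)%E.

(* The members of X are Borel representatives of classes modulo a.e. equality.
   X need not contain all the representatives of a class. *)
Record admissible (p : R) (g G : R -> R) (X : set ('rV[R]_n -> R)) : Prop := {
  adm_nonempty : X !=set0 ;
  adm_loc : forall u, X u -> locally_integrable_rV u ;
  adm_level : forall u (alpha : R), X u -> 0 < alpha ->
    (lebesgue_rV n [set x | (alpha < `|u x|)%R] < +oo)%E ;
  adm_g : forall u, X u -> locally_integrable_rV (g \o u) ;
  adm_weak : forall u, X u -> weakly_differentiable u ;
  adm_grad : forall u, X u -> (lebesgue_rV n).-integrable setT
    (fun x => (enorm (weak_gradient u x) `^ p)%:E) ;
  adm_G : forall u, X u -> (lebesgue_rV n).-integrable setT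
    (fun x => (G (u x))%:E) ;
  adm_dilate : forall u (sigma : R), X u -> 0 < sigma -> X (dilate sigma u) ;
  adm_fold : forall u (a : 'rV[R]_n) (c : R), X u -> a != 0 ->
    X (fold_pos a c u) /\ X (fold_neg a c u)
}.

End calculus_rV.

Definition minimizer {R : realType} {T : Type} (J : T -> \bar R) (S : set T)
    (u : T) : Prop :=
  S u /\ forall v, S v -> (J u <= J v)%E.

(* Main.v *)
Require Import Defs.
From mathcomp Require Import all_boot all_order all_algebra.
From mathcomp Require Import all_classical all_reals all_analysis.
From mathcomp Require Import measurable_realfun.
From mathcomp Require Import ring lra.

Import Order.TTheory GRing.Theory Num.Theory.
Import numFieldNormedType.Exports.

Local Open Scope classical_set_scope.
Local Open Scope ring_scope.

(** The energy J is a local functional of the weak gradient, and a truncation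
    only erases part of that gradient: this drives the theorem. Write u+ = max(u, 0) and u- = min(u, 0).

    Truncating lowers the energy, strictly unless nothing is cut off
    ([energy_truncation]): if v = min(u, c) or v = max(u, c), the gradient of v
    is that of u where v = u and is zero where v = c, so J v <= J u. If
    J v = J u then u - v has a zero weak gradient; it is therefore invariant by
    translations, and as its level sets {|u - v| > a} have finite measure it
    vanishes almost everywhere.

    Truncating kills a positive potential ([truncate_potential]). In case (a)
    the integrability of G(u) forces G(0) = 0, the space having infinite
    measure, hence V u = V u+ + V u-. If V u > 0, one of the two parts, say u+,
    has positive potential. The map t |-> V (min (u+, t)) is continuous, is
    nonpositive at t = eps because G <= 0 on [0, eps], and cannot stay negative
    for all t ([exists_truncation_potential_eq0]); so it vanishes for some
    t >= eps. This gives w nonzero with V w = 0 and J w <= J u, where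
    J u <= J w happens only if u = w almost everywhere.

    Both infima in (a) thus agree, and a minimizer u of the relaxed problem
    cannot have V u > 0, for then u = w and V u = V w = 0. Moreover, if V u >= 0
    and u+ is nonzero, then u+ or u- is nonzero with nonnegative potential; it
    is a competitor that costs no more than u, so it equals u, and u has a
    constant sign. Case (b) is case (a) for - G.

    The bulk of the file proves the locality of the weak gradient used above,
    namely that a weak partial derivative of f vanishes almost everywhere on
    {f = c} when f >= c, or f <= c ([weak_partial_extremum]). Testing against
    products of translated smooth bumps and applying Fubini's theorem shows
    that f (x + h e) - f x is the integral of the weak derivative over the
    segment from x to x + h e, for almost every x ([weak_partial_increment]). At
    a point of {f = c} the increments in the directions e and - e have the same
    sign, and Lebesgue's differentiation theorem on almost every line parallel
    to e passes this sign to the derivative. *)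

(** * Smooth bump functions on the line *)
Section smooth_real.
Context {R : realType}.
Implicit Types (f g : R -> R) (P : {poly R}).

(** Smoothness is phrased through the existence of successive derivatives, so
    that closure under products is an induction without Leibniz formula. *)
Fixpoint times_derivable (n : nat) f : Prop :=
  if n is m.+1 then
    exists2 df : R -> R, (forall x, is_derive x (1 : R) f (df x)) & times_derivable m df
  else True.

Definition smooth_real f : Prop := forall n, times_derivable n f.

Lemma times_derivableS n f : times_derivable n.+1 f -> times_derivable n f.
Proof.
elim: n f => [//|n IH] f [df fd dfd]; exists df => //; exact: IH.
Qed.

Lemma times_derivable_cst n c : times_derivable n (fun=> c).
Proof.
elim: n c => [//|n IH] c; exists (fun=> 0); last exact: IH.
by move=> x; exact: is_derive_cst.
Qed.

Lemma times_derivableD n f g : times_derivable n f -> times_derivable n g ->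
  times_derivable n (fun x => f x + g x).
Proof.
elim: n f g => [//|n IH] f g [df fd dfd] [dg gd dgd].
exists (fun x => df x + dg x); last exact: IH.
by move=> x; exact: is_deriveD.
Qed.

Lemma times_derivableM n f g : times_derivable n f -> times_derivable n g ->
  times_derivable n (fun x => f x * g x).
Proof.
elim: n f g => [//|n IH] f g fn gn.
have [df fd dfd] := fn; have [dg gd dgd] := gn.
exists (fun x => f x * dg x + g x * df x).
  by move=> x; exact: is_deriveM.
by apply: times_derivableD; apply: IH => //; exact: times_derivableS.
Qed.

Lemma times_derivable_affine n f (k c : R) : times_derivable n f ->
  times_derivable n (fun x => f (k * x + c)).
Proof.
elim: n f => [//|n IH] f [df fd dfd].
exists (fun x => df (k * x + c) * k); last first.
  by apply: times_derivableM; [exact: IH|exact: times_derivable_cst].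
move=> x; apply: is_derive1_comp.
rewrite (_ : (fun y => k * y + c) = (k \*: id) + cst c) //.
rewrite -[X in is_derive _ _ _ X]addr0; apply: is_deriveD.
rewrite -[X in is_derive _ _ _ X]mulr1.
exact: (is_deriveZ k).
Qed.

Lemma smooth_real_derivative f : smooth_real f ->
  exists2 df, (forall x, is_derive x (1 : R) f (df x)) & smooth_real df.
Proof.
move=> sf; exists (fun x => 'D_1 f x).
  by move=> x; have [df fd _] := sf 1%N; have [dx _] := fd x; exact: DeriveDef.
move=> n; have [df fd] := sf n.+1; rewrite (_ : (fun x => 'D_1 f x) = df) //.
by apply/funext => x; have [] := fd x.
Qed.

Lemma smooth_real_continuous f : smooth_real f -> continuous f.
Proof.
move=> sf x; have [df fd _] := sf 1%N; have [+ _] := fd x.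
by move=> /derivable1_diffP /differentiable_continuous.
Qed.

(** The flat functions P(1/x) exp(-1/x), extended by 0 to x <= 0: this family is
    stable under derivation, whence the smoothness of exp(-1/x). *)
Definition exp_inv P (x : R) : R :=
  if 0 < x then P.[x^-1] * expR (- x^-1) else 0.

(** Each monomial is controlled by y^(i+1) / (i+1)! <= exp y at y = 1/x. The
    bound makes every function of the family continuous at 0 and, applied to
    X P, it also bounds the difference quotient of the P-th one at 0. *)
Lemma exp_inv_lip P : exists2 C, 0 <= C & forall x, `|exp_inv P x| <= C * `|x|.
Proof.
exists (\sum_(i < size P) `|P`_i| * i.+1`!%:R).
  by apply: sumr_ge0 => i _; rewrite mulr_ge0.
move=> x; rewrite /exp_inv; case: ifPn => [x0|_]; last first.
  by rewrite normr0 mulr_ge0// sumr_ge0// => i _; rewrite mulr_ge0.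
rewrite horner_coef mulr_suml (le_trans (ler_norm_sum _ _ _))// mulr_suml.
apply: ler_sum => i _; rewrite !normrM -!mulrA ler_wpM2l//.
rewrite (gtr0_norm (expR_gt0 _)) gtr0_norm ?exprn_gt0 ?invr_gt0//.
rewrite (gtr0_norm x0) expRN ler_pdivrMr ?expR_gt0//.
have h : 1 + x^-1 ^+ i.+1 / i.+1`!%:R <= expR (x^-1).
  by apply: expR_ge1Dxn; rewrite invr_ge0 ltW.
have f0 : (0 : R) < i.+1`!%:R by rewrite ltr0n fact_gt0.
have {}h : x^-1 ^+ i.+1 <= i.+1`!%:R * expR (x^-1).
  rewrite mulrC -ler_pdivrMr//; apply: le_trans h; lra.
rewrite -mulrA [x * _]mulrC mulrA -ler_pdivrMr//.
by rewrite -exprSr.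
Qed.

Lemma is_derive_exp_inv P x :
  is_derive x (1 : R) (exp_inv P) (exp_inv ('X^2 * (P - P^`())) x).
Proof.
have [x0|x0|->] := ltgtP x 0.
- rewrite [X in is_derive _ _ _ X]/exp_inv ltNge ltW//=.
  apply: (@near_eq_is_derive _ _ _ (cst 0)).
  near=> y; rewrite /exp_inv ltNge ifF //.
  by apply/negbTE; rewrite negbK; near: y; apply: lt_le_nbhsl.
- rewrite [X in is_derive _ _ _ X]/exp_inv x0.
  have dV : is_derive x (1 : R) (fun y => y^-1) (- x ^- 2 *: 1).
    by apply: is_deriveV; rewrite gt_eqF.
  have dP : is_derive x (1 : R) (fun y => P.[y^-1]) (P^`().[x^-1] * (- x ^- 2 *: 1)).
    by apply: (is_derive1_comp _ dV).
  have dE : is_derive x (1 : R) (fun y => expR (- y^-1))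
      (expR (- x^-1) * - (- x ^- 2 *: 1)).
    by apply: is_derive1_comp; apply: is_deriveN.
  have dPE := is_deriveM dP dE.
  apply: is_derive_eq.
    apply: near_eq_is_derive dPE.
    by near=> y; rewrite /exp_inv ifT //; near: y; exact: lt_nbhsr.
  rewrite !hornerE /= /GRing.scale /= !mulr1 -!exprVn; ring.
- rewrite [X in is_derive _ _ _ X]/exp_inv ltxx.
  have [C C0 HC] := exp_inv_lip ('X * P).
  have cv : h^-1 *: ((exp_inv P \o shift 0) (h *: (1:R)) - exp_inv P 0) @[h --> 0^']
      --> (0:R).
    apply/cvgr0Pnorm_le => e e0; near=> h.
    rewrite /= addr0 [h *: 1]mulr1 {2}/exp_inv ltxx subr0.
    have h0 : h != 0 by near: h; exact: nbhs_dnbhs_neq.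
    rewrite (_ : _ *: _ = exp_inv ('X * P) h); last first.
      by rewrite /exp_inv; case: ifP => _; rewrite ?scaler0// !hornerE -mulrA.
    apply: le_trans (HC h) _.
    have hd : `|h| <= e / (C + 1).
      by near: h; apply: dnbhs0_le; rewrite divr_gt0// ltr_wpDl.
    apply: le_trans (ler_wpM2l C0 hd) _.
    rewrite mulrCA ger_pMr// ler_pdivrMr ?ltr_wpDl// mul1r lerDl//.
  apply: DeriveDef; first by apply/cvg_ex; exists 0.
  exact/cvg_lim.
Unshelve. all: by end_near. Qed.

Lemma smooth_exp_inv P : smooth_real (exp_inv P).
Proof.
move=> n; elim: n P => [//|n IH] P.
by eexists; [exact: is_derive_exp_inv|exact: IH].
Qed.

(** As k grows these functions increase to the indicator of ]a, b[, so that
    smooth approximations of intervals come without convolution. *)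
Definition bump (k a b x : R) : R :=
  exp_inv 1 (k * (x - a)) * exp_inv 1 (k * (b - x)).

Lemma smooth_bump k a b : smooth_real (bump k a b).
Proof.
move=> n; apply: times_derivableM.
  rewrite (_ : (fun x => _) = (fun x => exp_inv 1 (k * x + - (k * a)))).
    by apply: times_derivable_affine; exact: smooth_exp_inv.
  by apply/funext => x; rewrite mulrBr.
rewrite (_ : (fun x => _) = (fun x => exp_inv 1 (- k * x + k * b))).
  by apply: times_derivable_affine; exact: smooth_exp_inv.
by apply/funext => x; congr exp_inv; ring.
Qed.

Lemma exp_inv1_ge0 x : 0 <= exp_inv 1 x.
Proof. by rewrite /exp_inv; case: ifP => // _; rewrite hornerC mul1r expR_ge0. Qed.

Lemma exp_inv1_le1 x : exp_inv 1 x <= 1.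
Proof.
rewrite /exp_inv; case: ifP => // x0.
by rewrite hornerC mul1r expR_le1 oppr_le0 invr_ge0 ltW.
Qed.

Lemma bump_ge0 k a b x : 0 <= bump k a b x.
Proof. by rewrite mulr_ge0// exp_inv1_ge0. Qed.

Lemma bump_le1 k a b x : bump k a b x <= 1.
Proof. by rewrite mulr_ile1// ?exp_inv1_ge0// exp_inv1_le1. Qed.

Lemma bump_eq0 k a b x : 0 < k -> ~~ (a < x < b) -> bump k a b x = 0.
Proof.
move=> k0; rewrite /bump /exp_inv !pmulr_rgt0// !subr_gt0 negb_and.
by case/orP => /negbTE ->; rewrite ?mul0r ?mulr0.
Qed.

Lemma bump_translate k a b s x : bump k a b (x - s) = bump k (a + s) (b + s) x.
Proof. by rewrite /bump; congr (exp_inv 1 (k * _) * exp_inv 1 (k * _)); ring. Qed.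

Lemma cvg_exp_inv_dilate x : 0 < x -> exp_inv 1 (n.+1%:R * x) @[n --> \oo] --> (1 : R).
Proof.
move=> x0; rewrite (_ : (fun n => _) = (fun n => expR (- (n.+1%:R^-1 * x^-1)))).
  have h1 : (n.+1%:R^-1 * x^-1 : R) @[n --> \oo] --> 0 * x^-1.
    by apply: cvgM; [exact: cvg_harmonic|exact: cvg_cst].
  have h : (- (n.+1%:R^-1 * x^-1) : R) @[n --> \oo] --> (0 : R).
    by rewrite mul0r in h1; rewrite -oppr0; exact: (cvgN h1).
  have := cvg_comp _ _ h (@continuous_expR R 0).
  by rewrite expR0.
by apply/funext => n; rewrite /exp_inv pmulr_rgt0// x0 hornerC mul1r invfM.
Qed.

Lemma cvg_bump a b x :
  bump n.+1%:R a b x @[n --> \oo] --> (((a < x < b)%R)%:R : R).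
Proof.
have [/andP[ax xb]|abx] := boolP (a < x < b).
  rewrite -subr_gt0 in ax; rewrite -subr_gt0 in xb.
  have := cvgM (cvg_exp_inv_dilate _ ax) (cvg_exp_inv_dilate _ xb).
  by rewrite mulr1; exact.
rewrite (_ : (fun n => _) = fun=> 0); first exact: cvg_cst.
by apply/funext => n; rewrite bump_eq0.
Qed.

End smooth_real.

(** * Products of bumps are test functions *)
Section product_functions.
Context {R : realType} {n : nat}.
Implicit Types (F : 'I_n -> R -> R) (x a b : 'rV[R]_n).

Definition prodf F x : R := \prod_i F i (x ord0 i).

Lemma is_derive_line (phi : 'rV[R]_n -> R) x e s d :
  is_derive (x + s *: e) e phi d ->
  is_derive s (1 : R) (fun t => phi (x + t *: e)) d.
Proof.
have E : (fun h : R => h^-1 *: (((fun t => phi (x + t *: e)) \o shift s) (h *: (1 : R))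
     - phi (x + s *: e))) =
   (fun h : R => h^-1 *: ((phi \o shift (x + s *: e)) (h *: e) - phi (x + s *: e))).
  apply/funext => h /=; congr (_ *: (phi _ - _)).
  by rewrite [h *: 1]mulr1 scalerDl addrCA.
move=> [dx <-]; apply: DeriveDef.
  by rewrite /derivable E.
by rewrite /derive E.
Qed.

(** A partial derivative only differentiates one factor, so products of
    functions of one coordinate are stable under iterated partial derivatives. *)
Lemma is_derive_prodf F df i x : is_derive (x ord0 i) (1 : R) (F i) (df (x ord0 i)) ->
  is_derive x (basisv i) (prodf F)
    (prodf (fun j => if j == i then df else F j) x).
Proof.
move=> [dF vF].
have xi h j : (h *: basisv i + x : 'rV_n) ord0 j = (if j == i then h else 0) + x ord0 j.
  by rewrite !mxE eqxx /=; case: eqP; rewrite ?mulr1 ?mulr0.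
pose C := \prod_(j | j != i) F j (x ord0 j).
have E h : prodf F (h *: basisv i + x) = F i (h + x ord0 i) * C.
  rewrite /prodf (bigD1 i)//= xi eqxx; congr (_ * _).
  by apply: eq_bigr => j /negbTE ji; rewrite xi ji add0r.
have E0 : prodf F x = F i (x ord0 i) * C.
  by have := E 0; rewrite scale0r !add0r; exact.
have -> : prodf (fun j => if j == i then df else F j) x = df (x ord0 i) * C.
  rewrite /prodf (bigD1 i)//= eqxx; congr (_ * _).
  by apply: eq_bigr => j /negbTE ->.
have cv : h^-1 *: ((prodf F \o shift x) (h *: basisv i) - prodf F x) @[h --> 0^']
    --> df (x ord0 i) * C.
  rewrite (_ : (fun h => _) = (fun h => h^-1 *: ((F i \o shift (x ord0 i)) (h *: (1 :
      R)) -
    F i (x ord0 i)) * C)); last first.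
    apply/funext => h /=; rewrite E E0 [h *: 1]mulr1 -mulrBl.
    by rewrite /GRing.scale /= mulrA.
  apply: cvgM; last exact: cvg_cst.
  by rewrite -vF; move: dF => /cvg_ex[/= l dl]; rewrite /derive (cvg_lim _ dl).
apply: DeriveDef; first by apply/cvg_ex; eexists; exact: cv.
exact/cvg_lim.
Qed.

Lemma continuous_prodf F : (forall i, continuous (F i)) -> continuous (prodf F).
Proof.
move=> cF; rewrite /prodf.
have : forall s : seq 'I_n, continuous (fun x => \prod_(i <- s) F i (x ord0 i)).
  elim=> [|i s IH] x.
    rewrite (_ : (fun y => _) = cst 1); first exact: cst_continuous.
    by apply/funext => y; rewrite big_nil.
  rewrite (_ : (fun y => _) = (fun y : 'rV[R]_n => F i (y ord0 i) *
    (\prod_(i <- s) F i (y ord0 i)))); last first.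
    by apply/funext => y; rewrite big_cons.
  have c1 : {for x, continuous (fun y : 'rV[R]_n => F i (y ord0 i))}.
    apply: (@continuous_comp _ _ _ (fun y : 'rV[R]_n => y ord0 i) (F i)).
      exact: coord_continuous.
    exact: cF.
  exact: (continuousM c1 (IH x)).
exact.
Qed.

Lemma smooth_prodf F : (forall i, smooth_real (F i)) -> smooth (prodf F).
Proof.
move=> sF s.
have [F' [sF' ->]] : exists F', (forall i, smooth_real (F' i)) /\
    iter_partial s (prodf F) = prodf F'.
  elim: s => [|i s [F' [sF' IH]]]; first by exists F.
  have [df dF sdf] := smooth_real_derivative _ (sF' i).
  exists (fun j => if j == i then df else F' j); split.
    by move=> j; case: ifP.
  apply/funext => x; rewrite /= -/(iter_partial s (prodf F)) IH.
  by have [_ ->] := is_derive_prodf F' df i x (dF _).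
split.
  by apply: continuous_prodf => i; exact: smooth_real_continuous.
move=> i x; have [df dF sdf] := smooth_real_derivative _ (sF' i).
by have [] := is_derive_prodf F' df i x (dF _).
Qed.

Definition box a b : set 'rV[R]_n :=
  [set x | forall i, a ord0 i < x ord0 i < b ord0 i].

Definition box_bump k a b : 'rV[R]_n -> R :=
  prodf (fun i => bump k (a ord0 i) (b ord0 i)).

Lemma box_bump_ge0 k a b x : 0 <= box_bump k a b x.
Proof. by apply: prodr_ge0 => i _; exact: bump_ge0. Qed.

Lemma box_bump_le1 k a b x : box_bump k a b x <= 1.
Proof. by apply: prodr_ile1 => i _; rewrite bump_ge0 bump_le1. Qed.

Lemma box_bump_eq0 k a b x : 0 < k -> ~ box a b x -> box_bump k a b x = 0.
Proof.
move=> k0 /existsNP[i /negP abx].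
by rewrite /box_bump /prodf (bigD1 i)//= bump_eq0// mul0r.
Qed.

Lemma box_bump_translate k a b y x :
  box_bump k a b (x - y) = box_bump k (a + y) (b + y) x.
Proof. by apply: eq_bigr => i _; rewrite !mxE bump_translate. Qed.

Lemma test_function_box_bump k a b : 0 < k -> test_function (box_bump k a b).
Proof.
move=> k0; split; first by apply: smooth_prodf => i; exact: smooth_bump.
apply: (@subclosed_compact _ _ [set v : 'rV[R]_n |
    forall i, `[a ord0 i, b ord0 i]%classic (v ord0 i)]).
- exact: closed_closure.
- by apply: (@rV_compact _ _ (fun i => `[a ord0 i, b ord0 i]%classic)) => i; exact:
    segment_compact.
have cl : closed [set v : 'rV[R]_n | forall i, `[a ord0 i, b ord0 i]%classic (v ord0 i)].
  apply: compact_closed; first exact: norm_hausdorff.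
  by apply: (@rV_compact _ _ (fun i => `[a ord0 i, b ord0 i]%classic)) => i; exact:
      segment_compact.
rewrite [X in _ `<=` X](closure_id _).1//; apply: closure_subset => x /= /eqP x0 i.
have : box a b x by apply: contrapT => /(box_bump_eq0 k a b x k0).
by move=> /(_ i) /andP[? ?]; rewrite /= in_itv /= !ltW.
Qed.

Lemma cvg_box_bump a b x : box_bump m.+1%:R a b x @[m --> \oo] --> (\1_(box a b) x : R).
Proof.
have -> : \1_(box a b) x = \prod_(i < n) (a ord0 i < x ord0 i < b ord0 i)%R%:R :> R.
  rewrite indicE; have [/set_mem h|h] := boolP (x \in box a b).
    by rewrite big1// => i _; rewrite h.
  move/negP: h; rewrite inE => /existsNP[i /negP/negbTE h].
  by rewrite (bigD1 i)//= h mul0r.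
rewrite /box_bump /prodf.
have : forall s : seq 'I_n, \prod_(i <- s) bump m.+1%:R (a ord0 i) (b ord0 i) (x ord0 i)
    @[m --> \oo] --> (\prod_(i <- s) (a ord0 i < x ord0 i < b ord0 i)%R%:R : R).
  elim=> [|i s IH].
    under eq_fun do rewrite big_nil; rewrite big_nil; exact: cvg_cst.
  under eq_fun do rewrite big_cons; rewrite big_cons.
  by apply: cvgM; [exact: cvg_bump|exact: IH].
exact.
Qed.

End product_functions.

(** * Lebesgue measure on row vectors: boxes, translations and shears *)
Section boxes.
Context {R : realType} {n : nat}.
Implicit Types (a b x y : 'rV[R]_n).
Local Notation mu := (@lebesgue_rV R n).

Definition boxes : set (set 'rV[R]_n) := [set A | exists a b, A = box a b].

Lemma measurable_box a b : measurable (box a b).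
Proof.
rewrite (_ : box a b = \bigcap_(i in [set: 'I_n])
   (rV_coord i @^-1` `]a ord0 i, b ord0 i[%classic)).
  apply: fin_bigcap_measurable => // i _; rewrite -[X in measurable X]setTI.
  exact: measurable_rV_coord.
apply/seteqP; split => [x abx i _|x abx i]; rewrite /= ?in_itv/=.
  exact: abx.
by have := abx i I; rewrite /= in_itv.
Qed.

Lemma setI_closed_boxes : setI_closed boxes.
Proof.
move=> _ _ [a [b ->]] [c [d ->]].
exists (\row_i Num.max (a ord0 i) (c ord0 i)).
exists (\row_i Num.min (b ord0 i) (d ord0 i)).
apply/seteqP; split => [x [h1 h2] i|x h].
  have /andP[? ?] := h1 i; have /andP[? ?] := h2 i.
  by rewrite !mxE gt_max lt_min; apply/andP; split; apply/andP.
split => i; have := h i; rewrite !mxE gt_max lt_min => /andP[/andP[? ?] /andP[? ?]];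
  exact/andP.
Qed.

Definition cube (m : R) : set 'rV[R]_n := box (const_mx (- m)) (const_mx m).

Lemma cubeP m x : cube m x <-> forall i, `|x ord0 i| < m.
Proof.
by split => h i; have := h i; rewrite !mxE ltr_norml.
Qed.

Lemma cube_cover : \bigcup_k cube k%:R = setT.
Proof.
apply/seteqP; split => // x _.
pose M := \sum_(i < n) `|x ord0 i|.
exists (Num.bound M) => //; apply/cubeP => i.
apply: (@le_lt_trans _ _ M).
  by rewrite /M (bigD1 i)//= lerDl sumr_ge0.
exact: archi_boundP (sumr_ge0 _ _).
Qed.

Lemma lebesgue_rV_boxE a b :
  mu (box a b) = (\prod_(i < n) lebesgue_measure (`]a ord0 i, b ord0 i[%classic : set
      R))%E.
Proof.
rewrite -lebesgue_rV_box; last by move=> i; exact: measurable_itv.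
congr (mu _); apply/seteqP; split => x h i; have := h i; rewrite /= ?in_itv/=; exact.
Qed.

Lemma lebesgue_rV_box_lty a b : (mu (box a b) < +oo)%E.
Proof.
rewrite lebesgue_rV_boxE.
suff : (\prod_(i < n) lebesgue_measure (`]a ord0 i, b ord0 i[%classic : set R))%E \is a
    fin_num.
  by rewrite ge0_fin_numE// prode_ge0.
apply: prode_fin_num => i _; rewrite lebesgue_measure_itv/=.
by case: ifP.
Qed.

(** Half-spaces {c < x_i} are countable unions of boxes, and they generate the
    coordinate preimages of Borel sets. Together with [setI_closed_boxes] this
    reduces identities between measures to boxes. *)
Lemma measurable_rV_boxes : @measurable _ 'rV[R]_n = <<s boxes >>.
Proof.
apply/seteqP; split; last first.
  apply: smallest_sub; first exact: sigma_algebra_measurable.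
  by move=> _ [a [b ->]]; exact: measurable_box.
apply: smallest_sub; first exact: smallest_sigma_algebra.
rewrite -bigcup_seq; apply: bigcup_sub => i _ _ [B mB <-]; rewrite setTI.
move: B mB.
suff : @measurable _ (measurableTypeR R) `<=` [set B | <<s boxes >> (rV_coord i @^-1`
    B)] by [].
rewrite (_ : @measurable _ (measurableTypeR R) = <<s @RGenOInfty.G R >>); last exact:
    RGenOInfty.measurableE.
apply: smallest_sub.
  split => /=.
  - by rewrite preimage_set0; exact: sigma_algebra0.
  - by move=> A sA; rewrite setTD preimage_setC; exact: sigma_algebraC.
  - by move=> F sF; rewrite preimage_bigcup; exact: sigma_algebra_bigcup.
move=> _ [c ->] /=.
rewrite (_ : _ @^-1` _ = \bigcup_k box (\row_j (if j == i then c else - k%:R))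
    (const_mx k%:R)).
  apply: sigma_algebra_bigcup => k; apply: sub_sigma_algebra.
  by eexists; eexists; reflexivity.
apply/seteqP; split => x /=; rewrite in_itv/= andbT.
  move=> cx; have : (\bigcup_k cube k%:R) x by rewrite cube_cover.
  move=> [k _ /cubeP xk]; exists k => // j; rewrite !mxE.
  have := xk j; rewrite ltr_norml => /andP[h1 h2].
  by rewrite h2 andbT; case: eqP => [->|_]; [exact: cx|exact: h1].
by move=> [k _ /(_ i)]; rewrite !mxE eqxx => /andP[].
Qed.


Lemma measurable_rV_translation y : measurable_fun [set: 'rV[R]_n] (fun x => x + y).
Proof.
apply/measurable_fun_rVP => i.
rewrite (_ : _ \o _ = (fun x => rV_coord i x + y ord0 i)); last first.
  by apply/funext => x; rewrite /= /rV_coord mxE.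
by apply: measurable_funD => //; exact: measurable_rV_coord.
Qed.

Lemma lebesgue_rV_translation y (A : set 'rV[R]_n) : measurable A ->
  mu ((fun x => x + y) @^-1` A) = mu A.
Proof.
move=> mA; apply/esym.
pose m := measure_function_pushforward__canonical__measure_function_Measure
  mu (measurable_rV_translation y).
change (mu A = m A).
apply: (measure_unique boxes (fun k => cube k%:R) measurable_rV_boxes setI_closed_boxes
    _ cube_cover mu m) => //.
- by move=> k; eexists; eexists; reflexivity.
- move=> _ [a [b ->]]; rewrite /m /= /pushforward.
  rewrite (_ : _ @^-1` _ = box (a - y) (b - y)).
    rewrite !lebesgue_rV_boxE; apply: eq_bigr => i _.
    rewrite !lebesgue_measure_itv/= !lte_fin !mxE ltrD2r; case: ifP => // _.
    by rewrite -!EFinD; congr EFin; ring.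
  apply/seteqP; split => x h i; have := h i; rewrite !mxE.
    by rewrite ltrBlDr ltrBrDr.
  by rewrite ltrBlDr ltrBrDr.
- by move=> k; exact: lebesgue_rV_box_lty.
Qed.

Lemma lebesgue_rV_setT : (0 < n)%N -> mu setT = +oo%E.
Proof.
move=> n0; have -> : setT = [set v : 'rV[R]_n | forall i, setT (v ord0 i)].
  by apply/seteqP; split.
rewrite (@lebesgue_rV_box _ _ (fun=> [set: measurableTypeR R]))//.
have -> : lebesgue_measure [set: measurableTypeR R] = +oo%E.
  by rewrite -set_itvNyy lebesgue_measure_itv.
case: n n0 => // k _; elim: k => [|k IH]; first by rewrite big_ord_recl big_ord0 mule1.
by rewrite big_ord_recl IH mulyy.
Qed.

End boxes.

Section measure_preserving.
Context d d' (T : measurableType d) (T' : measurableType d') (R : realType).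
Variables (m : {measure set T -> \bar R}) (m' : {measure set T' -> \bar R}).
Variable phi : T -> T'.
Hypothesis mphi : measurable_fun setT phi.
Hypothesis pres : forall A, measurable A -> m (phi @^-1` A) = m' A.

Lemma integral_measure_preserving (f : T' -> \bar R) : measurable_fun setT f ->
  (\int[m']_y f y = \int[m]_x f (phi x))%E.
Proof.
move=> mf; pose p := measure_function_pushforward__canonical__measure_function_Measure
    m mphi.
have E g : measurable_fun setT g -> (forall y, 0 <= g y)%E ->
    (\int[m']_y g y = \int[m]_x g (phi x))%E.
  move=> mg g0; rewrite (eq_measure_integral p); last first.
    by move=> A mA _; rewrite -pres.
  by rewrite ge0_integral_pushforward.
rewrite integralE [RHS]integralE (E f^\+%E)//; last exact: measurable_funepos.
rewrite (E f^\-%E); [|exact: measurable_funeneg|by []].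
by congr (_ - _)%E; apply: eq_integral => x _; rewrite ?funeposE ?funenegE.
Qed.

Lemma integrable_measure_preserving (f : T' -> \bar R) :
  m'.-integrable setT f -> m.-integrable setT (f \o phi).
Proof.
move=> /integrableP[mf fi]; apply/integrableP; split; first exact: measurableT_comp.
by rewrite -(integral_measure_preserving (abse \o f))//; exact: measurableT_comp.
Qed.

End measure_preserving.
Arguments integral_measure_preserving {d d' T T' R m m' phi} mphi pres f.
Arguments integrable_measure_preserving {d d' T T' R m m' phi} mphi pres f.

(** The shear (s, x) |-> (s, x + s e) straightens the lines parallel to e: it
    turns statements about almost every line into statements about almost every
    point, without choosing coordinates adapted to e. *)
Section shear.
Context {R : realType} {n : nat}.
Local Notation mu := (@lebesgue_rV R n).
Local Notation leb := (@lebesgue_measure R).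
Variable e : 'rV[R]_n.

Definition shear (z : measurableTypeR R * 'rV[R]_n) : measurableTypeR R * 'rV[R]_n :=
  (z.1, z.2 + (z.1 : R) *: e).

Lemma measurable_shear : measurable_fun setT shear.
Proof.
apply: measurable_fun_pair => //=; apply/measurable_fun_rVP => i.
rewrite (_ : _ \o _ = (fun z => (rV_coord i \o snd) z + z.1 * e ord0 i)); last first.
  by apply/funext => z; rewrite /= /rV_coord !mxE.
apply: measurable_funD; first exact: measurableT_comp (measurable_rV_coord i)
    measurable_snd.
by apply: measurable_funM => //; exact: measurable_fst.
Qed.

(** Each slice at fixed s is a translation, so that both measures agree on
    rectangles. *)
Lemma shear_preserving A : measurable A ->
  (leb \x mu)%E (shear @^-1` A) = (leb \x mu)%E A.
Proof.
move=> mA; apply/esym.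
pose m := measure_function_pushforward__canonical__measure_function_Measure
  (leb \x mu)%E measurable_shear.
change ((leb \x mu)%E A = m A).
apply: product_measure_unique => // B C mB mC.
rewrite /m /= /pushforward /product_measure1.
transitivity (\int[leb]_(s in B) mu C)%E; last by rewrite integral_cst// muleC.
rewrite [RHS]integral_mkcond; apply: eq_integral => s _ /=.
rewrite patchE; case: ifPn => sB.
  rewrite -(lebesgue_rV_translation ((s : R) *: e) C mC); congr (mu _).
  apply/seteqP; split => x; rewrite /xsection /= inE/=; first by case.
  by move=> Cx; split => //; rewrite inE in sB.
rewrite (_ : xsection _ _ = set0) ?measure0//.
rewrite -subset0 => x; rewrite /xsection /= inE/= => -[Bs _].
by move/negP: sB; apply; exact: mem_set.
Qed.

End shear.

(** * Functions orthogonal to all bumps vanish almost everywhere *)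
Section locally_integrable_cubes.
Context {R : realType} {n : nat}.
Implicit Types (a b x y : 'rV[R]_n) (f w q : 'rV[R]_n -> R).
Local Notation mu := (@lebesgue_rV R n).

(** Cubes are Borel for the coordinate sigma-algebra and exhaust the space, and
    they spare any discussion of the measurability of compact sets. *)
Definition loc_int f : Prop := measurable_fun setT f /\
  forall k : nat, mu.-integrable (cube k%:R) (EFin \o f).

Lemma loc_int_of_locally_integrable f : locally_integrable_rV f -> loc_int f.
Proof.
move=> [mf cf]; split => // k; apply/integrableP; split.
  by apply/measurable_EFinP; exact: measurable_funTS.
pose K := [set v : 'rV[R]_n | forall i, `[- k%:R, k%:R]%classic (v ord0 i)].
have cK : compact K.
  apply: (@rV_compact R n (fun i => `[(- k%:R : R), k%:R]%classic)) => i.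
  exact: segment_compact.
have mK : measurable K.
  rewrite (_ : K = \bigcap_(i in [set: 'I_n])
     (rV_coord i @^-1` `[- k%:R, k%:R]%classic)).
    apply: fin_bigcap_measurable => // i _; rewrite -[X in measurable X]setTI.
    exact: measurable_rV_coord.
  by apply/seteqP; split => [x Kx i _|x Kx i]; [exact: Kx|exact: (Kx i I)].
apply: le_lt_trans (cf K cK); apply: ge0_subset_integral => //.
- exact: measurable_box.
- by do 2 apply: measurableT_comp => //; exact: measurable_funTS.
- move=> x /cubeP xk i; rewrite /= in_itv/= -ler_norml; exact/ltW/xk.
Qed.

Lemma loc_intB f q : loc_int f -> loc_int q -> loc_int (f \- q).
Proof.
move=> [mf fi] [mq qi]; split; first exact: measurable_funB.
by move=> k; have := integrableB (measurable_box _ _) (fi k) (qi k).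
Qed.

Lemma ae_cubes (P : 'rV[R]_n -> Prop) :
  (forall k : nat, {ae mu, forall x, cube k%:R x -> P x}) -> {ae mu, forall x, P x}.
Proof.
move=> h; have := negligible_bigcup h; apply: negligibleS => x Px.
have : (\bigcup_k cube k%:R) x by rewrite cube_cover.
by move=> [k _ xk]; exists k => // /(_ xk).
Qed.

(** The sets E for which q has zero integral on E and the cube form a Dynkin
    system containing the boxes. *)
Lemma ae_eq0_boxes q : loc_int q ->
  (forall a b, \int[mu]_(x in box a b) (q x)%:E = 0)%E ->
  {ae mu, forall x, q x = 0}.
Proof.
move=> [mq qi] q0; apply: ae_cubes => k.
have mC : measurable (cube k%:R : set 'rV[R]_n) by exact: measurable_box.
have main E : measurable E -> (\int[mu]_(x in E `&` cube k%:R) (q x)%:E = 0)%E.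
  rewrite measurable_rV_boxes; move: E.
  pose P E := (\int[mu]_(x in E `&` cube k%:R) (q x)%:E = 0)%E.
  apply: (@dynkin_induction _ _ boxes P measurable_rV_boxes setI_closed_boxes); rewrite
      /P.
  - by rewrite setTI q0.
  - move=> A bA; have : boxes (A `&` cube k%:R).
      by apply: setI_closed_boxes => //; eexists; eexists.
    by move=> [a [b ->]].
  - move=> S mS S0; have := q0 (const_mx (- k%:R)) (const_mx k%:R).
    have CE : cube k%:R = S `&` cube k%:R `|` ~` S `&` cube k%:R :> set 'rV[R]_n.
      by rewrite -setIUl setUv setTI.
    rewrite -/(cube k%:R) {1}CE integral_setU //.
    + by rewrite S0 add0e; exact.
    + exact: measurableI.
    + by apply: measurableI => //; exact: measurableC.
    + by apply/measurable_EFinP; exact: measurable_funTS.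
    + by apply/disj_set2P; rewrite setIACA setICr set0I.
  - move=> F mF tF F0; rewrite setI_bigcupl integral_bigcup.
    + by rewrite eseries0// => i _ _; exact: F0.
    + exact: trivIset_setIr.
    + by move=> i; exact: measurableI.
    + apply: integrableS (qi k) => //; first by apply: bigcup_measurable => i _; exact:
        measurableI.
      by move=> x [i _ []].
have := @integral_ae_eq _ _ _ mu _ mC (cst 0%E) (EFin \o q) (qi k).
move=> /(_ (measurable_cst _)) H.
have : ae_eq mu (cube k%:R) (EFin \o q) (cst 0%E).
  apply: H => E EC mE; rewrite -(setIidl EC) main //.
  by rewrite integral0.
by apply: filterS => x h /h [].
Qed.

Lemma box_subset_cube a b : exists k : nat, box a b `<=` cube k%:R.
Proof.
pose M := \sum_(i < n) (`|a ord0 i| + `|b ord0 i|).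
exists (Num.bound M) => x abx; apply/cubeP => i.
have hM : `|a ord0 i| + `|b ord0 i| <= M.
  by rewrite /M (bigD1 i)//= lerDl sumr_ge0.
have MB : M < (Num.bound M)%:R.
  by apply: archi_boundP; apply: sumr_ge0 => j _; rewrite addr_ge0.
have /andP[ax xb] := abx i.
apply: le_lt_trans MB; apply: le_trans hM; rewrite ler_norml; apply/andP; split.
  have := lerNnormlW (lexx `|a ord0 i|); have := normr_ge0 (b ord0 i); lra.
have := ler_norm (b ord0 i); have := normr_ge0 (a ord0 i); lra.
Qed.

Lemma measurable_box_bump k a b : measurable_fun setT (box_bump k a b).
Proof.
apply: measurable_prod => i _.
apply: measurableT_comp (measurable_rV_coord i).
by apply: continuous_measurable_fun; apply: smooth_real_continuous; exact: smooth_bump.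
Qed.

Lemma loc_int_box f a b : loc_int f -> mu.-integrable (box a b) (EFin \o f).
Proof.
move=> [mf fi]; have [k abk] := box_subset_cube a b.
by apply: integrableS abk (fi k); exact: measurable_box.
Qed.

(** The fundamental lemma of the calculus of variations, restricted to the
    bumps; these converge to indicators of boxes under a fixed dominating
    function. *)
Lemma ae_eq0_bumps q : loc_int q ->
  (forall (k : R) a b, 0 < k -> (\int[mu]_x (q x * box_bump k a b x)%:E)%E = 0%E) ->
  {ae mu, forall x, q x = 0}.
Proof.
move=> qi q0; apply: (ae_eq0_boxes _ qi) => a b.
have mab : measurable (box a b) by exact: measurable_box.
have h : (\int[mu]_(x in box a b) (q x * box_bump m.+1%:R a b x)%:E)%E @[m --> \oo]
    --> (\int[mu]_(x in box a b) (q x)%:E)%E.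
  apply: (@dominated_cvg _ _ _ mu _ mab
    (fun m x => (q x * box_bump m.+1%:R a b x)%:E) (EFin \o q) (fun x => `|q x|%:E)).
  - move=> m; apply/measurable_EFinP; apply: measurable_funM; apply: measurable_funTS.
      exact: qi.1.
    exact: measurable_box_bump.
  - move=> x xab; apply: cvg_EFin; first exact: nearW.
    rewrite /comp /= -[X in _ --> X]mulr1.
    apply: cvgM; first exact: cvg_cst.
    by have := cvg_box_bump a b x; rewrite indicE mem_set.
  - by [].
  - by have := integrable_norm (loc_int_box _ a b qi).
  - move=> m x xab; rewrite /= lee_fin normrM ler_piMr//.
    by rewrite ger0_norm ?box_bump_ge0// box_bump_le1.
have E m : (\int[mu]_(x in box a b) (q x * box_bump m.+1%:R a b x)%:E)%E = 0%E.
  rewrite -(q0 m.+1%:R a b)// [LHS]integral_mkcond; apply: eq_integral => x _.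
  rewrite patchE; case: ifPn => // xab.
  by rewrite box_bump_eq0 ?mulr0// => abx; move/negP : xab; apply; exact: mem_set.
rewrite (_ : (fun m => _) = (fun=> 0%E)) in h; last exact/funext.
apply/esym; apply: (@cvg_unique _ _ _ _ _ _ _ h) => //.
exact: cvg_cst.
Qed.

End locally_integrable_cubes.

(** * Partial derivatives of bumps *)
Section bump_derivatives.
Context {R : realType}.
Implicit Types (k a b x s : R).

(** The derivative of [exp_inv 1], in the form given by [is_derive_exp_inv]. *)
Definition exp_inv_deriv : R -> R := exp_inv ('X^2 * (1 - (1 : {poly R})^`())).

Definition bump_deriv k a b x : R :=
  k * exp_inv_deriv (k * (x - a)) * exp_inv 1 (k * (b - x)) -
  exp_inv 1 (k * (x - a)) * (k * exp_inv_deriv (k * (b - x))).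

Lemma is_derive_bump k a b x : is_derive x (1 : R) (bump k a b) (bump_deriv k a b x).
Proof.
have D (c d : R) : is_derive x (1 : R) (fun y => exp_inv 1 (c * y + d))
    (exp_inv_deriv (c * x + d) * c).
  apply: (@is_derive1_comp _ (exp_inv 1) (fun y => c * y + d)).
    exact: is_derive_exp_inv.
  rewrite (_ : (fun y => c * y + d) = (c \*: id) + cst d) //.
  rewrite -[X in is_derive _ _ _ X]addr0; apply: is_deriveD.
  rewrite -[X in is_derive _ _ _ X]mulr1.
  exact: (is_deriveZ c).
have -> : bump k a b = (fun y => exp_inv 1 (k * y + - (k * a)) ) *
    (fun y => exp_inv 1 (- k * y + k * b)).
  by apply/funext => y; rewrite /bump !fctE; congr (exp_inv 1 _ * exp_inv 1 _); ring.
apply: (is_derive_eq (is_deriveM (D k (- (k * a))) (D (- k) (k * b)))).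
rewrite /bump_deriv /GRing.scale /=.
have -> : k * x + - (k * a) = k * (x - a) by ring.
have -> : - k * x + k * b = k * (b - x) by ring.
ring.
Qed.

Lemma bump_deriv_eq0 k a b x : 0 < k -> ~~ (a < x < b) -> bump_deriv k a b x = 0.
Proof.
move=> k0; rewrite /bump_deriv /exp_inv_deriv /exp_inv !pmulr_rgt0// !subr_gt0 negb_and.
by case/orP => /negbTE ->; rewrite ?(mul0r, mulr0) subrr.
Qed.

Lemma bump_deriv_bounded k a b : 0 < k -> exists M, forall x, `|bump_deriv k a b x| <= M.
Proof.
move=> k0; have [C C0 HC] := exp_inv_lip ('X^2 * (1 - (1 : {poly R})^`())).
exists (k * (C * (k * `|b - a|)) + k * (C * (k * `|b - a|))) => x.
have [/andP[ax xb]|abx] := boolP (a < x < b); last first.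
  by rewrite bump_deriv_eq0// normr0 addr_ge0// !mulr_ge0// ltW.
have H y : 0 <= y <= `|b - a| -> `|exp_inv_deriv (k * y)| <= C * (k * `|b - a|).
  move=> /andP[y0 yb]; apply: le_trans (HC _) _; rewrite ler_wpM2l//.
  by rewrite normrM (gtr0_norm k0) ler_pM2l// ger0_norm.
have E y : `|exp_inv 1 y : R| <= 1 by rewrite ger0_norm ?exp_inv1_ge0 ?exp_inv1_le1.
have ab : a < b by exact: lt_trans xb.
have H1 : `|exp_inv_deriv (k * (x - a))| <= C * (k * `|b - a|).
  by apply: H; rewrite gtr0_norm; lra.
have H2 : `|exp_inv_deriv (k * (b - x))| <= C * (k * `|b - a|).
  by apply: H; rewrite gtr0_norm; lra.
apply: le_trans (ler_normB _ _) _; rewrite !normrM (gtr0_norm k0).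
apply: lerD.
  rewrite -mulrA ler_pM2l//; apply: le_trans H1; rewrite ler_piMr//.
rewrite mulrCA ler_pM2l//; apply: le_trans H2; rewrite ler_piMl//.
Qed.

Lemma continuous_bump_deriv k a b : continuous (bump_deriv k a b).
Proof.
have [df dF sdf] := smooth_real_derivative _ (smooth_bump k a b).
rewrite (_ : bump_deriv k a b = df); first exact: smooth_real_continuous.
apply/funext => x; have [_ <-] := dF x; by have [_ <-] := is_derive_bump k a b x.
Qed.

Lemma bump_deriv_translate k a b s x : bump_deriv k a b (x - s) = bump_deriv k (a + s)
    (b + s) x.
Proof.
rewrite /bump_deriv; have -> : x - s - a = x - (a + s) by ring.
by have -> : b - (x - s) = b + s - x by ring.
Qed.

Context {n : nat}.
Implicit Types (u v y : 'rV[R]_n) (i : 'I_n).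

Definition partial_bump k u v i : 'rV[R]_n -> R :=
  prodf (fun j => if j == i then bump_deriv k (u ord0 i) (v ord0 i)
                  else bump k (u ord0 j) (v ord0 j)).

Lemma is_derive_box_bump k u v i y :
  is_derive y (basisv i) (box_bump k u v) (partial_bump k u v i y).
Proof. apply: is_derive_prodf; exact: is_derive_bump. Qed.

Lemma partial_bump_eq0 k u v i y : 0 < k -> ~ box u v y -> partial_bump k u v i y = 0.
Proof.
move=> k0 /existsNP[j /negP uvy].
rewrite /partial_bump /prodf (bigD1 j)//=.
by case: eqP uvy => [->|_] uvy; rewrite ?bump_deriv_eq0 ?bump_eq0// mul0r.
Qed.

Lemma continuous_partial_bump k u v i : continuous (partial_bump k u v i).
Proof.
apply: continuous_prodf => j; case: ifP => _; first exact: continuous_bump_deriv.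
exact: smooth_real_continuous (smooth_bump _ _ _).
Qed.

Lemma measurable_partial_bump k u v i : measurable_fun setT (partial_bump k u v i).
Proof.
apply: measurable_prod => j _.
apply: measurableT_comp (measurable_rV_coord j).
apply: continuous_measurable_fun; case: ifP => _; first exact: continuous_bump_deriv.
exact: smooth_real_continuous (smooth_bump _ _ _).
Qed.

Lemma partial_bump_bounded k u v i : 0 < k ->
  exists M, forall y, `|partial_bump k u v i y| <= M.
Proof.
move=> k0; have [M HM] := bump_deriv_bounded k (u ord0 i) (v ord0 i) k0.
exists M => y; rewrite /partial_bump /prodf (bigD1 i)//= eqxx normrM.
apply: le_trans (HM (y ord0 i)); rewrite ler_piMr// normr_prod.
apply: prodr_ile1 => j ji; rewrite (negbTE ji) normr_ge0/=.
by rewrite ger0_norm ?bump_ge0 ?bump_le1.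
Qed.

Lemma partial_bump_translate k u v i w y :
  partial_bump k u v i (y - w) = partial_bump k (u + w) (v + w) i y.
Proof.
apply: eq_bigr => j _; rewrite !mxE; case: eqP => [->|_].
  by rewrite bump_deriv_translate.
by rewrite bump_translate.
Qed.

Lemma integral_partial_bump_line k u v i (e h : R) y : 0 < h ->
  (\int[lebesgue_measure]_(s in `[0%R, h]) (e * partial_bump k u v i (y - s *: (e *:
      basisv i)))%:E =
  (box_bump k u v y - box_bump k u v (y - h *: (e *: basisv i)))%:E)%E.
Proof.
move=> h0.
pose F s := - box_bump k u v (y - s *: (e *: basisv i)).
pose f s := e * partial_bump k u v i (y - s *: (e *: basisv i)).
have E s : y - s *: (e *: basisv i) = y + (- e * s) *: basisv i.
  by rewrite scalerA -scaleNr; congr (_ + _ *: _); ring.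
have dF s : is_derive s (1 : R) F (f s).
  have -> : F = - ((fun t => box_bump k u v (y + t *: basisv i)) \o (fun t => - e * t)).
    by apply/funext => t; rewrite /F !fctE /= E.
  have -> : f s = - (partial_bump k u v i (y + (- e * s) *: basisv i) * - e).
    by rewrite /f E; ring.
  apply: is_deriveN; apply: is_derive1_comp.
    by apply: is_derive_line; exact: is_derive_box_bump.
  rewrite (_ : (fun t => - e * t) = (- e) \*: id) //.
  rewrite -[X in is_derive _ _ _ X]mulr1.
  exact: (is_deriveZ (- e)).
have cf : continuous f.
  move=> s; rewrite /f; apply: cvgM; first exact: cvg_cst.
  have cl : {for s, continuous (fun s : R => y - s *: (e *: basisv i))}.
    by apply: cvgB; [exact: cvg_cst|apply: cvgZr_tmp; exact: cvg_id].
  by apply: (continuous_comp cl); exact: continuous_partial_bump.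
have cF : continuous F.
  move=> s; have [+ _] := dF s.
  by move=> /derivable1_diffP /differentiable_continuous.
rewrite (@continuous_FTC2 _ f F)//.
- by rewrite /F scale0r subr0 -EFinB; congr EFin; ring.
- exact: continuous_subspaceT.
- split; first by move=> s _; have [] := dF s.
  + apply: cvg_at_right_filter; exact: cF.
  + apply: cvg_at_left_filter; exact: cF.
- by move=> s _; rewrite derive1E; have [_ ->] := dF s.
Qed.

End bump_derivatives.

(** * Integrals along segments *)
Section increments.
Context {R : realType} {n : nat}.
Local Notation mu := (@lebesgue_rV R n).
Local Notation leb := (@lebesgue_measure R).
Implicit Types (f w q : 'rV[R]_n -> R) (x y e : 'rV[R]_n) (h : R).

Lemma cube_shift (k : nat) e h : exists k' : nat, forall x s, cube k%:R x -> `|s| <= h ->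
  cube k'%:R (x + s *: e).
Proof.
pose M := \sum_(i < n) `|e ord0 i|.
exists (Num.bound (k%:R + `|h| * M)) => x s /cubeP xk sh; apply/cubeP => i.
apply: (@le_lt_trans _ _ (k%:R + `|h| * M)); last first.
  by apply: archi_boundP; rewrite addr_ge0// mulr_ge0// sumr_ge0.
rewrite !mxE (le_trans (ler_normD _ _))// lerD//; first exact/ltW/xk.
rewrite normrM ler_pM//; first exact: le_trans (ler_norm _).
by rewrite /M (bigD1 i)//= lerDl sumr_ge0.
Qed.

Lemma integrable_patch_cube w (k : nat) : loc_int w ->
  mu.-integrable setT (EFin \o (fun x => \1_(cube k%:R) x * w x)).
Proof.
move=> [mw wi]; have := wi k.
rewrite (integrable_mkcond _ (measurable_box _ _)).
apply: eq_integrable => // x _ /=.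
by rewrite patchE indicE; case: ifP => _; rewrite ?mul1r ?mul0r.
Qed.

Lemma loc_int_translation f y : loc_int f -> loc_int (fun x => f (x + y)).
Proof.
move=> fi; have [mf _] := fi; split.
  exact: measurableT_comp mf (measurable_rV_translation y).
move=> k; have [k' Hk'] := cube_shift k y 1.
have := integrable_measure_preserving (measurable_rV_translation y)
  (lebesgue_rV_translation y) _ (integrable_patch_cube f k' fi).
move=> /(integrableS measurableT (measurable_box _ _) (@subsetT _ (cube k%:R))).
apply: eq_integrable; first exact: measurable_box.
move=> x /set_mem xk /=; rewrite indicE mem_set ?mul1r//.
by have := Hk' x 1 xk; rewrite normr1 scale1r; apply.
Qed.

Lemma integrable_strip g h : mu.-integrable setT (EFin \o g) ->
  (leb \x mu)%E.-integrable setT (fun z => (\1_(`[0, h]) z.1 * g z.2)%:E).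
Proof.
move=> gi; have /integrableP[/measurable_EFinP mg gfin] := gi.
have mf : measurable_fun setT (fun z : measurableTypeR R * 'rV[R]_n =>
    (\1_(`[0, h]) z.1 * g z.2)%:E).
  apply/measurable_EFinP; apply: measurable_funM.
    by apply: measurableT_comp => //; exact: measurable_indic.
  exact: measurableT_comp.
apply/integrable12ltyP => //=.
under eq_integral => s _.
  under eq_integral do rewrite normrM EFinM.
  rewrite ge0_integralZl//; last by do 2 apply: measurableT_comp => //.
  over.
rewrite ge0_integralZr//.
- under eq_integral do rewrite ger0_norm//.
  rewrite integral_indic// setIT lte_mul_pinfty//.
  have : lebesgue_measure (`[0, h]%classic : set R) \is a fin_num.
    by rewrite lebesgue_measure_itv/=; case: ifP.
  exact.
- by do 2 apply: measurableT_comp => //; exact: measurable_indic.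
- by apply: integral_ge0.
Qed.


Lemma measurable_line e w : measurable_fun setT w ->
  measurable_fun setT (fun z : measurableTypeR R * 'rV[R]_n => w (z.2 + (z.1 : R) *: e)).
Proof.
move=> mw.
have := measurableT_comp mw (measurableT_comp measurable_snd (measurable_shear e)).
exact.
Qed.

Lemma measurable_on_line e w x : measurable_fun setT w ->
  measurable_fun setT (fun s : measurableTypeR R => w (x + (s : R) *: e)).
Proof.
move=> mw; apply: measurableT_comp mw _; apply/measurable_fun_rVP => i.
rewrite (_ : _ \o _ = (fun s => x ord0 i + s * e ord0 i)); last first.
  by apply/funext => s; rewrite /= /rV_coord !mxE.
by apply: measurable_funD => //; apply: measurable_funM.
Qed.

(** This is the image by the shear of a function that is integrable on a strip:
    translates x + s e with x in a cube and s bounded stay in a larger cube. *)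
Lemma integrable_line_strip e h (k : nat) w : loc_int w ->
  (leb \x mu)%E.-integrable setT
    (fun z => (\1_(`[0, h]) z.1 * (\1_(cube k%:R) z.2 * w (z.2 + (z.1 : R) *: e)))%:E).
Proof.
move=> wi; have [k' Hk'] := cube_shift k e h.
have L0 := integrable_strip _ h (integrable_patch_cube w k' wi).
have L := integrable_measure_preserving (measurable_shear e) (shear_preserving e) _ L0.
apply: le_integrable L => //.
  apply/measurable_EFinP; apply: measurable_funM.
    by apply: measurableT_comp => //; exact: measurable_indic.
  apply: measurable_funM; last by apply: measurable_line; exact: wi.1.
  by apply: measurableT_comp => //; apply: measurable_indic; exact: measurable_box.
move=> [s x] _ /=; rewrite lee_fin.
rewrite !indicE; case: (boolP (s \in _)) => [/set_mem/=|_]; last by rewrite !mul0r.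
rewrite in_itv/= => /andP[s0 sh].
case: (boolP (x \in _)) => [/set_mem xk|_]; last by rewrite mul0r mulr0 normr0.
rewrite mem_set//; apply: Hk' => //; by rewrite ger0_norm.
Qed.

Definition line_int e h w x : R := \int[leb]_(s in `[0, h]) w (x + s *: e).

Lemma line_intE e h w x :
  line_int e h w x = fine (\int[leb]_s (\1_(`[0, h]) s * w (x + s *: e))%:E).
Proof.
rewrite /line_int /Rintegral integral_mkcond; congr fine.
apply: eq_integral => s _; rewrite patchE indicE.
by case: ifP => _; rewrite ?mul1r ?mul0r.
Qed.

Lemma measurable_line_int e h w : measurable_fun setT w ->
  measurable_fun setT (line_int e h w).
Proof.
move=> mw; rewrite (_ : line_int e h w = fine \o
   (fun x => \int[leb]_s (\1_(`[0, h]) s * w (x + s *: e))%:E)%E); last first.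
  by apply/funext => x; rewrite line_intE.
apply: measurableT_comp => //.
pose F (z : measurableTypeR R * 'rV[R]_n) := (\1_(`[0, h]) z.1 * w (z.2 + (z.1 : R) *:
    e))%:E.
have mF : measurable_fun setT F.
  apply/measurable_EFinP; apply: measurable_funM; last exact: measurable_line.
  by apply: measurableT_comp => //; exact: measurable_indic.
rewrite (_ : (fun x => _) = (fun x => \int[leb]_s F^\+ (s, x) - \int[leb]_s F^\- (s,
    x))%E).
  apply: emeasurable_funB.
    exact: (measurable_fun_fubini_tonelli_G (F^\+)%E (measurable_funepos mF)).
  exact: (measurable_fun_fubini_tonelli_G (F^\-)%E (measurable_funeneg mF)).
apply/funext => x; rewrite integralE.
by congr (_ - _)%E; apply: eq_integral => s _; rewrite ?funeposE ?funenegE.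
Qed.

(** Tonelli's theorem bounds the integral over a cube of the modulus of
    [line_int] by the integral of [integrable_line_strip]. *)
Lemma loc_int_line_int e h w : loc_int w -> loc_int (line_int e h w).
Proof.
move=> wi; split; first by apply: measurable_line_int; exact: wi.1.
move=> k; have Ki := integrable_line_strip e h k w wi.
have mK := measurable_int _ Ki.
apply/integrableP; split.
  by apply/measurable_EFinP; apply: measurable_funTS; apply: measurable_line_int;
      exact: wi.1.
move/integrable21ltyP : Ki => /(_ mK); apply: le_lt_trans.
set F := fun y => (\int[leb]_x `|_|)%E.
have mF : measurable_fun setT F.
  apply: (@measurable_fun_fubini_tonelli_G _ _ _ _ _ leb (abse \o (fun z :
      measurableTypeR R * 'rV[R]_n => (\1_(`[0, h]) z.1 * (\1_(cube k%:R) z.2 * w (z.2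
      + (z.1 : R) *: e)))%:E))).
    exact: measurableT_comp.
  by move=> z; exact: abse_ge0.
have F0 y : (0 <= F y)%E by apply: integral_ge0.
apply: (@le_trans _ _ (\int[mu]_(x in cube k%:R) F x)%E).
  apply: ge0_le_integral => //.
  - exact: measurable_box.
  - do 2 apply: measurableT_comp => //; apply: measurable_funTS.
    by apply: measurable_line_int; exact: wi.1.
  - exact: measurable_funTS.
  - move=> x xk; rewrite /= line_intE /F.
    have x1 : \1_(cube k%:R) x = 1 :> R by rewrite indicE mem_set.
    under [X in (_ <= X)%E]eq_integral do rewrite /= x1 mul1r.
    set I := (\int[leb]_s _)%E.
    have : (`|I| <= \int[leb]_s `|(\1_(`[0%R, h]) s * w (x + (s : R) *: e))%R|%:E)%E.
      apply: le_trans (le_abse_integral _ _ _) _ => //.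
      apply/measurable_EFinP; apply: measurable_funM; first exact: measurable_indic.
      exact: measurable_on_line wi.1.
    apply: le_trans; case: I => [r||] //=; by rewrite normr0 // leey.
apply: ge0_subset_integral => //; exact: measurable_box.
Qed.

End increments.

(** * Weak partial derivatives as increments *)
Section weak_partial.
Context {R : realType} {n : nat}.
Local Notation mu := (@lebesgue_rV R n).
Local Notation leb := (@lebesgue_measure R).
Implicit Types (f w q : 'rV[R]_n -> R) (a b x y e : 'rV[R]_n) (h c k : R) (i : 'I_n).

(** Only product bumps are used as test functions; they determine w almost
    everywhere and they form a family stable under translation. *)
Definition weak_partial i f w : Prop := [/\ loc_int f, loc_int w &
  forall k a b, 0 < k ->
    (\int[mu]_x (f x * partial_bump k a b i x)%:E =
     - \int[mu]_x (w x * box_bump k a b x)%:E)%E].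

Lemma loc_intZ c f : loc_int f -> loc_int (fun x => c * f x).
Proof.
move=> [mf fi]; split; first exact: measurable_funM.
move=> k; exact: (@integrableZl _ _ _ mu _ (measurable_box _ _) c _ (fi k)).
Qed.

Lemma integrable_mul_supported f (phi : 'rV[R]_n -> R) M a b : loc_int f ->
  measurable_fun setT phi -> (forall x, `|phi x| <= M) ->
  (forall x, ~ box a b x -> phi x = 0) ->
  mu.-integrable setT (fun x => (f x * phi x)%:E).
Proof.
move=> fi mphi phiM phi0.
have mab : measurable (box a b) by exact: measurable_box.
have := loc_int_box f a b fi.
rewrite (integrable_mkcond _ mab) => /(integrableZl measurableT M).
apply: le_integrable => //.
  by apply/measurable_EFinP; apply: measurable_funM => //; exact: fi.1.
move=> x _; rewrite patchE; case: ifPn => [_|xab].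
  rewrite /= lee_fin !normrM mulrC ler_wpM2r//.
  exact: le_trans (ler_norm _).
rewrite phi0 ?mulr0 ?abse0// => abx; move/negP : xab; apply; exact: mem_set.
Qed.

Lemma integrable_mul_box_bump f k a b : 0 < k -> loc_int f ->
  mu.-integrable setT (fun x => (f x * box_bump k a b x)%:E).
Proof.
move=> k0 fi; apply: (integrable_mul_supported _ _ 1 a b fi).
- exact: measurable_box_bump.
- by move=> x; rewrite ger0_norm ?box_bump_ge0 ?box_bump_le1.
- by move=> x; exact: box_bump_eq0.
Qed.

Lemma integrable_mul_partial_bump f k a b i : 0 < k -> loc_int f ->
  mu.-integrable setT (fun x => (f x * partial_bump k a b i x)%:E).
Proof.
move=> k0 fi; have [M HM] := partial_bump_bounded k a b i k0.
apply: (integrable_mul_supported _ _ M a b fi) => //.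
- exact: measurable_partial_bump.
- by move=> x; exact: partial_bump_eq0.
Qed.

Lemma weak_partialB i f w f' w' : weak_partial i f w -> weak_partial i f' w' ->
  weak_partial i (f \- f') (w \- w').
Proof.
move=> [fi wi fw] [fi' wi' fw']; split; [exact: loc_intB|exact: loc_intB|].
move=> k a b k0.
have E g g' phi : (fun x : 'rV[R]_n => (((g \- g') x : R) * phi x)%:E) =
    (fun x => (g x * phi x)%:E - (g' x * phi x)%:E)%E.
  by apply/funext => x; rewrite -EFinB /= mulrBl.
have i1 := integrable_mul_box_bump _ _ a b k0 wi.
have i2 := integrable_mul_box_bump _ _ a b k0 wi'.
rewrite !E !integralB//; try exact: integrable_mul_partial_bump.
rewrite fw// fw'// oppeB ?oppeK// fin_num_adde_defr//.
exact: integrable_fin_num.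
Qed.

Lemma weak_partial_ae i f w w' : weak_partial i f w -> loc_int w' ->
  {ae mu, forall x, w x = w' x} -> weak_partial i f w'.
Proof.
move=> [fi wi fw] wi' ww'; split => // k a b k0; rewrite fw//; congr (- _)%E.
apply: ae_eq_integral => //.
- exact: measurable_int (integrable_mul_box_bump _ _ a b k0 wi).
- exact: measurable_int (integrable_mul_box_bump _ _ a b k0 wi').
- by apply: filterS ww' => x /= -> _.
Qed.

Lemma weak_partial_of_gradient u (w : 'rV[R]_n -> 'rV[R]_n) i : locally_integrable_rV u ->
  is_weak_gradient u w -> weak_partial i u (fun x => w x ord0 i).
Proof.
move=> ui /(_ i)[wi uw]; split; [exact: loc_int_of_locally_integrable|exact:
    loc_int_of_locally_integrable|].
move=> k a b k0; rewrite -uw; last exact: test_function_box_bump.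
by apply: eq_integral => x _; have [_ ->] := is_derive_box_bump k a b i x.
Qed.

(** For a bump phi and e = c basisv i, the two kernels express the integral of
    f (x) (phi (x) - phi (x - h e)) in two ways. Integrating [kernel_partial]
    in s first gives this increment of phi by the fundamental theorem of
    calculus; integrating in x first, the weak derivative replaces f by w, and
    a translation moves the shift from phi to w, which is [kernel_bump]. *)
Section fubini_kernels.
Variables (i : 'I_n) (k : R) (a b : 'rV[R]_n) (c h : R).
Hypotheses (k0 : 0 < k) (h0 : 0 < h).
Let e : 'rV[R]_n := c *: basisv i.
Let phi := box_bump k a b.
Let dphi := partial_bump k a b i.

Definition kernel_partial f (z : measurableTypeR R * 'rV[R]_n) : \bar R :=
  (\1_(`[0, h]) z.1 * (f z.2 * (c * dphi (z.2 - (z.1 : R) *: e))))%:E.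

Definition kernel_bump w (z : measurableTypeR R * 'rV[R]_n) : \bar R :=
  (\1_(`[0, h]) z.1 * (c * phi z.2 * w (z.2 + (z.1 : R) *: e)))%:E.

Lemma integrable_kernel_partial f : loc_int f -> (leb \x mu)%E.-integrable setT
    (kernel_partial f).
Proof.
move=> fi; have [k1 Hk1] := box_subset_cube a b.
have [k2 Hk2] := cube_shift k1 e h.
have [M HM] := partial_bump_bounded k a b i k0.
have := integrable_strip _ h (integrable_patch_cube f k2 fi).
move=> /(integrableZl measurableT (`|c| * M)); apply: le_integrable => //.
  apply/measurable_EFinP; apply: measurable_funM.
    by apply: measurableT_comp => //; exact: measurable_indic.
  apply: measurable_funM; first by apply: measurableT_comp measurable_snd; exact: fi.1.
  apply: measurable_funM => //.
  have := measurable_line (- e) dphi (measurable_partial_bump k a b i).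
  by under eq_fun do rewrite scalerN.
move=> [s x] _ /=; rewrite lee_fin.
rewrite !indicE; case: (boolP (s \in _)) => [/set_mem/=|_]; last first.
  by rewrite !mul0r mulr0.
rewrite in_itv/= => /andP[s0 sh]; rewrite !mul1r.
case: (boolP (x \in _)) => [_|/negP xk].
  rewrite mul1r 2!normrM [leRHS]normrM mulrC ler_wpM2r//.
  by apply: le_trans (ler_norm _); rewrite ler_wpM2l.
rewrite (_ : dphi _ = 0) ?mulr0 ?normr0 ?mulr0 ?mul0r ?normr0//.
apply: partial_bump_eq0 => // xse; apply: xk; apply: mem_set.
have := Hk2 _ s (Hk1 _ xse); rewrite subrK ger0_norm//; exact.
Qed.

Lemma integrable_kernel_bump w : loc_int w -> (leb \x mu)%E.-integrable setT
    (kernel_bump w).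
Proof.
move=> wi; have [k1 Hk1] := box_subset_cube a b.
have := integrable_line_strip e h k1 w wi.
move=> /(integrableZl measurableT `|c|); apply: le_integrable => //.
  apply/measurable_EFinP; apply: measurable_funM.
    by apply: measurableT_comp => //; exact: measurable_indic.
  apply: measurable_funM; last by apply: measurable_line; exact: wi.1.
  apply: measurable_funM => //; apply: measurableT_comp measurable_snd.
  exact: measurable_box_bump.
move=> [s x] _ /=; rewrite lee_fin.
rewrite !indicE; case: (boolP (s \in _)) => [/set_mem/=|_]; last first.
  by rewrite !mul0r mulr0.
rewrite in_itv/= => /andP[s0 sh]; rewrite !mul1r.
case: (boolP (x \in _)) => [_|/negP xk].
  rewrite mul1r !normrM normr_id ler_wpM2r// ler_piMr//.
  by rewrite ger0_norm ?box_bump_ge0 ?box_bump_le1.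
rewrite (_ : phi _ = 0) ?mulr0 ?mul0r ?normr0 ?mulr0//.
by apply: box_bump_eq0 => // xab; apply: xk; apply: mem_set; exact: Hk1.
Qed.

Lemma kernel_partial_line f x :
  (\int[leb]_s kernel_partial f (s, x) = (f x * (phi x - phi (x - h *: e)))%:E)%E.
Proof.
have L := integral_partial_bump_line k a b i c h x h0.
have E : (fun s : measurableTypeR R => kernel_partial f (s, x)) =
    (fun s => (f x)%:E * ((fun s => (c * dphi (x - (s : R) *: e))%:E) \_ `[0%R, h]) s)%E.
  apply/funext => s; rewrite /kernel_partial patchE indicE /=.
  by case: ifP => _; rewrite ?mul1r ?mul0r ?mule0 -?EFinM.
have mg : measurable_fun setT ((fun s : measurableTypeR R => (c * dphi (x - (s : R) *:
    e))%:E) \_ `[0%R, h]).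
  apply/(measurable_restrictT _ _).1 => //; apply/measurable_EFinP.
  apply: measurable_funTS; apply: measurable_funM => //.
  have := measurable_on_line (- e) dphi x (measurable_partial_bump k a b i).
  by under eq_fun do rewrite scalerN.
rewrite E integralZl//.
  by rewrite -integral_mkcond L.
apply/integrableP; split => //.
by apply/abse_integralP => //; rewrite -integral_mkcond L /= ltry.
Qed.

Lemma kernel_partial_slice f w s : weak_partial i f w ->
  (\int[mu]_x kernel_partial f (s, x) = - \int[mu]_x kernel_bump w (s, x))%E.
Proof.
move=> [fi wi fw]; rewrite /kernel_partial /kernel_bump /dphi /phi /= indicE.
case: (boolP (s \in _)) => _; last first.
  by under eq_integral do rewrite mul0r; under [in RHS]eq_integral do rewrite mul0r;
    rewrite integral0 oppe0.
under eq_integral do rewrite mul1r mulrCA EFinM partial_bump_translate.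
under [in RHS]eq_integral do rewrite mul1r -mulrA EFinM.
rewrite integralZl//; last exact: integrable_mul_partial_bump.
rewrite fw// muleN; congr (- _)%E.
have wse := loc_int_translation w ((s : R) *: e) wi.
rewrite integralZl//; last first.
  have := integrable_mul_box_bump _ _ a b k0 wse.
  by under eq_fun do rewrite mulrC.
congr (_ * _)%E.
pose g x := (w x * box_bump k (a + (s : R) *: e) (b + (s : R) *: e) x)%:E.
rewrite (integral_measure_preserving (measurable_rV_translation ((s : R) *: e))
  (lebesgue_rV_translation ((s : R) *: e)) g).
  apply: eq_integral => x _; rewrite /g -box_bump_translate addrK.
  by rewrite mulrC.
exact: measurable_int (integrable_mul_box_bump _ _ _ _ k0 wi).
Qed.

Lemma kernel_bump_line w : loc_int w ->
  {ae mu, forall x, (\int[leb]_s kernel_bump w (s, x) =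
    (c * phi x * line_int e h w x)%:E)%E}.
Proof.
move=> wi; have := ae_integrable2 (integrable_kernel_bump w wi).
apply: filterS => x xi.
have E : (fun s : measurableTypeR R => kernel_bump w (s, x)) =
    (fun s => (c * phi x)%:E * (\1_(`[0%R, h]) s * w (x + (s : R) *: e))%:E)%E.
  by apply/funext => s; rewrite /kernel_bump /= -EFinM mulrCA.
have [cphi0|cphi0] := eqVneq (c * phi x) 0.
  by rewrite E cphi0 mul0r; under eq_integral do rewrite mul0e; rewrite integral0.
have wxi : leb.-integrable setT (fun s : measurableTypeR R => (\1_(`[0%R, h]) s * w (x
    + (s : R) *: e))%:E).
  rewrite E in xi; have := integrableZl measurableT (c * phi x)^-1 xi.
  by under eq_fun do rewrite -!EFinM mulKf//.
rewrite E integralZl// line_intE [RHS]EFinM fineK//.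
exact: integrable_fin_num wxi.
Qed.

End fubini_kernels.

(** Both sides are tested against every bump phi. The left-hand side becomes an
    integral of f against phi (x - h e) - phi (x), and Fubini's theorem for the
    two kernels turns it into the right-hand side. *)
Theorem weak_partial_increment i f w c h : weak_partial i f w -> 0 < h ->
  {ae mu, forall x, f (x + h *: (c *: basisv i)) - f x =
    c * line_int (c *: basisv i) h w x}.
Proof.
move=> fw h0; have [fi wi _] := fw; set e := c *: basisv i.
have li := loc_int_line_int e h w wi.
have fhi := loc_int_translation f (h *: e) fi.
pose q x := f (x + h *: e) - f x - c * line_int e h w x.
have qi : loc_int q by exact: (loc_intB _ _ (loc_intB _ _ fhi fi) (loc_intZ c _ li)).
suff : {ae mu, forall x, q x = 0}.
  by apply: filterS => x /eqP; rewrite subr_eq0 => /eqP.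
apply: (ae_eq0_bumps _ qi) => k a b k0.
have F : (\int[mu]_x (f x * (box_bump k a b x - box_bump k a b (x - h *: e)))%:E =
   - \int[mu]_x (c * line_int e h w x * box_bump k a b x)%:E)%E.
  under eq_integral do rewrite -(kernel_partial_line i k a b c h h0).
  rewrite -(Fubini (integrable_kernel_partial i k a b c h k0 f fi)).
  under eq_integral do rewrite (kernel_partial_slice i k a b c h k0 f w _ fw).
  have mG : measurable_fun setT (fun s : measurableTypeR R => \int[mu]_x kernel_bump i
      k a b c h w (s, x))%E.
    exact: (measurable_fubini_F (integrable_kernel_bump i k a b c h k0 w wi)).
  have iG := integrable_fubini_F (integrable_kernel_bump i k a b c h k0 w wi).
  rewrite integralN; last exact: integrable_add_def.
  rewrite (Fubini (integrable_kernel_bump i k a b c h k0 w wi)).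
  congr (- _)%E; apply: ae_eq_integral => //.
  - exact: (measurable_fubini_G (integrable_kernel_bump i k a b c h k0 w wi)).
  - exact: measurable_int (integrable_mul_box_bump _ _ a b k0 (loc_intZ c _ li)).
  - have := kernel_bump_line i k a b c h k0 w wi; apply: filterS => x /= -> _.
    by congr EFin; rewrite mulrAC.
have i1 := integrable_mul_box_bump _ _ a b k0 fi.
have i2 := integrable_mul_box_bump _ _ a b k0 fhi.
have i3 := integrable_mul_box_bump _ _ a b k0 (loc_intZ c _ li).
have i4 := integrable_mul_box_bump _ _ (a + h *: e) (b + h *: e) k0 fi.
have S : (\int[mu]_x (f x * box_bump k (a + h *: e) (b + h *: e) x)%:E =
    \int[mu]_x (f (x + h *: e) * box_bump k a b x)%:E)%E.
  rewrite (integral_measure_preserving (measurable_rV_translation (h *: e))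
    (lebesgue_rV_translation (h *: e))); last exact: measurable_int i4.
  by apply: eq_integral => x _; rewrite -box_bump_translate addrK.
have E1 : (\int[mu]_x (f x * (box_bump k a b x - box_bump k a b (x - h *: e)))%:E =
   \int[mu]_x (f x * box_bump k a b x)%:E -
   \int[mu]_x (f (x + h *: e) * box_bump k a b x)%:E)%E.
  rewrite -S -integralB//; apply: eq_integral => x _.
  by rewrite -EFinB -mulrBr box_bump_translate.
rewrite (_ : (fun x => _) = (fun x => (f (x + h *: e) * box_bump k a b x)%:E
   - (f x * box_bump k a b x)%:E -  (c * line_int e h w x * box_bump k a b x)%:E)%E);
       last first.
  by apply/funext => x; rewrite -!EFinB /q -!mulrBl.
rewrite integralB//; last exact: integrableB.
rewrite integralB//.
move: F; rewrite E1.
have := integrable_fin_num measurableT i1; have := integrable_fin_num measurableT i2.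
have := integrable_fin_num measurableT i3.
do 3 move=> /fineK <-.
rewrite -!EFinB -EFinN => -[F]; congr EFin; lra.
Qed.

End weak_partial.

(** * Lebesgue differentiation along lines *)
Section lebesgue_averages.
Context {R : realType}.
Local Notation leb := (@lebesgue_measure R).
Implicit Types (v : R -> R) (t h : R).

Lemma lebesgue_translation t (A : set (measurableTypeR R)) : measurable A ->
  leb ((fun s : measurableTypeR R => (t + s : measurableTypeR R)) @^-1` A) = leb A.
Proof.
have mt : measurable_fun setT (fun s : measurableTypeR R => (t + s : measurableTypeR R)).
  exact: measurable_funD.
move=> mA; apply/esym.
pose m := measure_function_pushforward__canonical__measure_function_Measure leb mt.
change (leb A = m A).
apply: lebesgue_measure_unique => // _ [[a b] _ <-].
rewrite /m /= /pushforward.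
rewrite (_ : _ @^-1` _ = `]a - t, b - t]%classic).
  rewrite !lebesgue_measure_itv/= !lte_fin ltrD2r; case: ifP => // _.
  by rewrite -!EFinB; congr EFin; ring.
by apply/seteqP; split => s; rewrite /= !in_itv/= ltrBlDl lerBrDl.
Qed.

Lemma Rintegral_translation v t h : measurable_fun setT v -> 0 <= h ->
  \int[leb]_(s in `[0, h]) v (t + s) = \int[leb]_(s in `[t, t + h]) v s.
Proof.
move=> mv h0; rewrite /Rintegral; congr fine.
rewrite integral_mkcond [RHS]integral_mkcond.
have mt : measurable_fun setT (fun s : measurableTypeR R => (t + s : measurableTypeR R)).
  exact: measurable_funD.
rewrite [RHS](integral_measure_preserving mt (lebesgue_translation t)).
  apply: eq_integral => s _; rewrite !patchE.
  have [/andP[s0 sh]|sh] := boolP (0 <= s <= h).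
    by rewrite !mem_set//= in_itv/= ?lerDl ?lerD2l ?s0.
  by rewrite !memNset//= in_itv/= ?lerDl ?lerD2l; exact/negP.
apply/(measurable_restrictT _ _).1 => //; apply/measurable_EFinP.
exact: measurable_funTS.
Qed.

(** The averages are difference quotients of a primitive of v along the
    sequence 1 / (m + 1). *)
Lemma ae_cvg_average v : leb.-integrable setT (EFin \o v) ->
  {ae leb, forall t, (m.+1%:R * \int[leb]_(s in `[0, m.+1%:R^-1]) v (t + s)) @[m -->
      \oo] --> v t}.
Proof.
move=> vi.
have vy y : leb.-integrable `]-oo, y] (EFin \o v) by exact: integrableS vi.
have mv : measurable_fun setT v by apply/measurable_EFinP; exact: measurable_int vi.
have vl : locally_integrable [set: R] v.
  split => //; first exact: openT.
  move=> K _ cK; have /integrableP[_] := vi; apply: le_lt_trans.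
  apply: ge0_subset_integral => //; first exact: compact_measurable.
  by do 2 apply: measurableT_comp => //.
have := FTC1Ny vy vl; set F := fun x => _.
apply: filterS; first exact: (ae_filter_ringOfSetsType leb).
move=> t [/= Fd F't].
have E m : m.+1%:R * \int[leb]_(s in `[0, m.+1%:R^-1]) v (t + s) =
    (m.+1%:R^-1)^-1 * ((F \o shift t) (m.+1%:R^-1 *: 1) - F t).
  rewrite invrK; congr (_ * _).
  rewrite Rintegral_translation//= [_ *: _]mulr1 /F addrC.
  rewrite Rintegral_itvB//=.
    rewrite Rintegral_itv_obnd_cbnd//.
    exact: integrableS vi.
  by rewrite bnd_simp lerDr.
have Fl : h^-1 *: ((F \o shift t) (h *: (1 : R)) - F t) @[h --> 0^'] --> v t.
  by rewrite -F't derive1E; move: Fd => /cvg_ex[/= l dl]; rewrite /derive (cvg_lim _ dl).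
have H : (m.+1%:R^-1)^-1 * ((F \o shift t) (m.+1%:R^-1 *: 1) - F t) @[m --> \oo] --> v t.
  apply: ((cvgr_dnbhsP _ _ _).1 Fl (fun m => m.+1%:R^-1)).
  by split => [j|]; [rewrite invr_neq0|exact: cvg_harmonic].
by apply: cvg_trans H; apply: near_eq_cvg; apply: nearW => m; rewrite E.
Qed.

End lebesgue_averages.

(** * The weak derivative vanishes at extremal levels *)
Section extremum.
Context {R : realType} {n : nat}.
Local Notation mu := (@lebesgue_rV R n).
Local Notation leb := (@lebesgue_measure R).
Implicit Types (f w q : 'rV[R]_n -> R) (a b x y e : 'rV[R]_n) (h c k : R) (i : 'I_n).

Lemma measurable_eq0 q : measurable_fun setT q -> measurable [set x | q x = 0].
Proof.
move=> mq; rewrite (_ : mkset _ = q @^-1` [set 0])//.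
by rewrite -[X in measurable X]setTI; exact: mq.
Qed.

(** The measure of [0, 1] x A, which is that of A, is preserved by the shear and
    computed line by line with Tonelli's theorem. *)
Lemma null_set_lines e (A : set 'rV[R]_n) : measurable A ->
  {ae mu, forall x, {ae leb, forall s, 0 <= s <= 1 -> ~ A (x + (s : R) *: e)}} ->
  mu A = 0%E.
Proof.
move=> mA hA.
pose I : set (measurableTypeR R) := `[0, 1]%classic.
have mI : measurable I by exact: measurable_itv.
pose S := I `*` A.
have mS : measurable S by exact: measurableX.
have mSe : measurable (shear e @^-1` S).
  by rewrite -[X in measurable X]setTI; exact: measurable_shear.
have : (leb \x mu)%E (shear e @^-1` S) = mu A.
  rewrite shear_preserving// product_measure1E//.
  rewrite -[RHS]mul1e; congr (_ * _)%E.
  have : lebesgue_measure (`[0, 1]%classic : set R) = 1%E.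
    by rewrite lebesgue_measure_itv/= lte_fin ltr01 oppr0 adde0.
  exact.
move=> <-; rewrite -(setIT (shear e @^-1` S)) -integral_indic//.
have mind : measurable_fun setT (EFin \o (\1_(shear e @^-1` S) : _ -> R)).
  by apply/measurable_EFinP; exact: measurable_indic.
rewrite (fubini_tonelli2 _ mind); last by move=> z; rewrite lee_fin.
rewrite (ae_eq_integral (cst 0%E))//; first by rewrite integral0.
  apply: (@measurable_fun_fubini_tonelli_G _ _ _ _ _ leb _ mind) => z.
  by rewrite lee_fin.
apply: filterS hA => x hx _; rewrite /fubini_G /=.
rewrite (ae_eq_integral (cst 0%E))//; first by rewrite integral0.
  apply/measurable_EFinP; apply: measurableT_comp; first exact: measurable_indic.
  exact: measurable_pair2.
apply: (@filterS _ _ (ae_filter_ringOfSetsType leb) _ _ _ hx) => s hs _ /=.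
congr EFin; rewrite indicE memNset//= => -[]; rewrite /I /= in_itv/= => s01.
exact: hs.
Qed.

Lemma ae_line_integrable e w (h : R) : loc_int w ->
  {ae mu, forall x, leb.-integrable setT
    (fun s : measurableTypeR R => (\1_(`[0, h]) s * w (x + (s : R) *: e))%:E)}.
Proof.
move=> wi; apply: ae_cubes => k.
apply: filterS (ae_integrable2 (integrable_line_strip e h k w wi)) => x xi xk.
apply: eq_integrable xi => // s _ /=.
by rewrite [in X in _ * X]indicE mem_set// mul1r.
Qed.

(** The set B of the points that violate the conclusion but satisfy the
    increment formula for all h = 1 / (m + 1) is null on almost every line in
    the direction t basisv i: there the averages of t w over segments issued from
    z are difference quotients of f at the extremal point z, so that s times
    them is nonnegative, and they converge to t w z by Lebesgue's
    differentiation theorem. *)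
Lemma weak_partial_sign i f w (c s t : R) : weak_partial i f w ->
  (forall x, 0 <= s * (f x - c)) ->
  {ae mu, forall x, f x = c -> 0 <= s * (t * w x)}.
Proof.
move=> fw fc; have [fi wi _] := fw; set e := t *: basisv i.
pose h (m : nat) : R := m.+1%:R^-1.
have h0 m : 0 < h m by rewrite invr_gt0.
pose B := [set x | f x - c = 0] `&` [set x | s * (t * w x) < 0] `&`
  \bigcap_m [set x | f (x + h m *: e) - f x - t * line_int e (h m) w x = 0].
have mB : measurable B.
  apply: measurableI; first apply: measurableI.
  - by apply: measurable_eq0; apply: measurable_funB => //; exact: fi.1.
  - rewrite (_ : mkset _ = (fun x => s * (t * w x)) @^-1` `]-oo, 0[%classic).
      rewrite -[X in measurable X]setTI.
      have mw : measurable_fun setT (fun x => s * (t * w x)).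
        by apply: measurable_funM => //; apply: measurable_funM => //; exact: wi.1.
      exact: mw.
    by apply/seteqP; split => x; rewrite /= in_itv.
  - apply: bigcapT_measurable => m; apply: measurable_eq0.
    apply: measurable_funB; first apply: measurable_funB; last first.
    + by apply: measurable_funM => //; apply: measurable_line_int; exact: wi.1.
    + exact: fi.1.
    + exact: (loc_int_translation f (h m *: e) fi).1.
have B0 : mu B = 0%E.
  apply: (null_set_lines e) => //.
  (* base points in [0, 1] and segments of length at most 1 stay in [0, 2] *)
  apply: filterS (ae_line_integrable e w 2 wi) => x xi.
  have := ae_cvg_average (fun r => \1_(`[0, 2]) r * w (x + r *: e)) xi.
  apply: filterS; first exact: (ae_filter_ringOfSetsType leb).
  move=> r rcv /andP[r0 r1] [[/= fr wr] LP].
  move: wr; apply/negP; rewrite -leNgt.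
  have E m : m.+1%:R * \int[leb]_(q in `[0, h m]) (\1_(`[0, 2]) (r + q) * w (x + (r +
      q) *: e))
      = m.+1%:R * line_int e (h m) w (x + r *: e).
    congr (_ * _); apply: eq_Rintegral => q; rewrite inE/= in_itv/= => /andP[q0 qh].
    rewrite indicE mem_set ?mul1r; first by rewrite -addrA -scalerDl.
    rewrite /= in_itv/= addr_ge0//= (_ : 2 = 1 + 1)// lerD//.
    by apply: le_trans qh _; rewrite invf_le1// ler1n.
  have wv : \1_(`[0, 2]) r * w (x + r *: e) = w (x + r *: e).
    by rewrite indicE mem_set ?mul1r//= in_itv/= r0 (le_trans r1)// ler1n.
  rewrite wv in rcv.
  have cv : s * (t * (m.+1%:R * line_int e (h m) w (x + r *: e))) @[m --> \oo]
      --> s * (t * w (x + r *: e)).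
    apply: cvgMl_tmp; apply: cvgMl_tmp.
    by apply: cvg_trans rcv; apply: near_eq_cvg; apply: nearW => m; rewrite E.
  apply: (cvgr_to_ge cv); apply: nearW => m.
  have /= LPm := LP m I.
  have -> : s * (t * (m.+1%:R * line_int e (h m) w (x + r *: e))) =
      m.+1%:R * (s * (t * line_int e (h m) w (x + r *: e))) by ring.
  rewrite mulr_ge0//.
  have -> : t * line_int e (h m) w (x + r *: e) = f (x + r *: e + h m *: e) - c by lra.
  exact: fc.
have LPae := weak_partial_increment i f w t _ fw (h0 _).
have bad : mu.-negligible (B `|` \bigcup_m ~` [set x | f (x + h m *: e) - f x =
    t * line_int e (h m) w x]).
  apply: negligibleU; first by exists B; split.
  by apply: negligible_bigcup => m; exact: LPae.
apply: negligibleS bad => x /= /not_implyP[fx /negP]; rewrite -ltNge => wx.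
have [LPx|] := pselect (forall m, f (x + h m *: e) - f x = t * line_int e (h m) w x).
  by left; split => [|m _ /=]; [split => //=; rewrite fx subrr|rewrite LPx subrr].
by move=> /existsNP[m LPm]; right; exists m.
Qed.

(** The factor s encodes both cases, f >= c for s > 0 and f <= c for s < 0. The
    sign lemma in the two opposite directions leaves w = 0. *)
Theorem weak_partial_extremum i f w (c s : R) : weak_partial i f w -> s != 0 ->
  (forall x, 0 <= s * (f x - c)) ->
  {ae mu, forall x, f x = c -> w x = 0}.
Proof.
move=> fw s0 fc.
have h1 := weak_partial_sign i f w c s 1 fw fc.
have h2 := weak_partial_sign i f w c s (- 1) fw fc.
apply: filterS2 h1 h2 => x h1 h2 fx; have := h1 fx; have := h2 fx.
rewrite mul1r mulN1r mulrN oppr_ge0 => le0 ge0.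
have /eqP : s * w x = 0 by apply/eqP; rewrite eq_le le0.
by rewrite mulf_eq0 (negbTE s0) => /eqP.
Qed.

Lemma weak_partial0_translation i f h : weak_partial i f (fun=> 0) -> 0 < h ->
  {ae mu, forall x, f (x + h *: basisv i) = f x}.
Proof.
move=> fw h0; have := weak_partial_increment i f _ 1 h fw h0.
apply: filterS => x; rewrite !scale1r mul1r /line_int.
by rewrite Rintegral_cst// mul0r => /eqP; rewrite subr_eq0 => /eqP.
Qed.

End extremum.

(** * Energy of truncations *)
Section integral_comparison.
Context d (T : measurableType d) (R : realType) (mu : {measure set T -> \bar R}).

Lemma ae_eq_le_integral (a b : T -> R) :
  mu.-integrable setT (EFin \o a) -> mu.-integrable setT (EFin \o b) ->
  {ae mu, forall x, b x <= a x} ->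
  (\int[mu]_x (a x)%:E <= \int[mu]_x (b x)%:E)%E ->
  {ae mu, forall x, a x = b x}.
Proof.
move=> ai bi ba Iab; have ci := integrableB measurableT ai bi.
have mc := measurable_int _ ci.
have ba_ae : ae_eq mu setT (abse \o ((EFin \o a) \- (EFin \o b)))%E
    ((EFin \o a) \- (EFin \o b))%E.
  apply: filterS ba => x h _ /=; rewrite ger0_norm// subr_ge0//.
have : (\int[mu]_x `|((EFin \o a) \- (EFin \o b)) x| = 0)%E.
  apply/eqP; rewrite eq_le integral_ge0// andbT.
  rewrite (ae_eq_integral _ _ _ _ _ ba_ae)//; last exact: measurableT_comp.
  by rewrite integralB// sube_le0.
move/(ae_eq_integral_abs _ measurableT mc).1.
by apply: filterS => x /(_ I) /= /eqP; rewrite eqe subr_eq0 => /eqP.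
Qed.

End integral_comparison.

Section truncation_energy.
Context {R : realType} {n : nat}.
Local Notation mu := (@lebesgue_rV R n).
Implicit Types (f u v w : 'rV[R]_n -> R) (x y e : 'rV[R]_n) (c p s : R) (i : 'I_n).

Lemma measurable_levels f (a : R) : measurable_fun setT f ->
  measurable [set x | a < `|f x|].
Proof.
move=> mf; rewrite (_ : mkset _ = (fun x => `|f x|) @^-1` `]a, +oo[%classic).
  rewrite -[X in measurable X]setTI.
  have mnf : measurable_fun setT (fun x => `|f x|) by exact: measurableT_comp.
  exact: mnf.
by apply/seteqP; split => x; rewrite /= in_itv/= andbT.
Qed.

(** For a level set A and a half-space {-K <= x_i}, a translation shows that the
    part of A in this half-space has the measure of the part of A in
    {j <= x_i}, for every j; the latter tends to 0 since A has finite measure. *)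
Lemma translation_invariant_eq0 i f : measurable_fun setT f ->
  (forall a, 0 < a -> (mu [set x | (a < `|f x|)%R] < +oo)%E) ->
  (forall h, 0 < h -> {ae mu, forall x, f (x + h *: basisv i) = f x}) ->
  {ae mu, forall x, f x = 0}.
Proof.
move=> mf flev fsh.
suff H (m : nat) : mu.-negligible [set x | m.+1%:R^-1 < `|f x|].
  have := negligible_bigcup H; apply: negligibleS => x /= /eqP fx0.
  have fx : 0 < `|f x| by rewrite normr_gt0.
  exists (Num.bound `|f x|^-1) => //=.
  rewrite invf_plt ?posrE ?ltr0n// -[_.+1]addn1 natrD ltr_wpDr//.
  by apply: archi_boundP; rewrite invr_ge0.
pose A := [set x | m.+1%:R^-1 < `|f x|].
have mA : measurable A by exact: measurable_levels.
have Afin : (mu A < +oo)%E by apply: flev; rewrite invr_gt0.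
pose half (k : R) : set 'rV[R]_n := [set x | k <= x ord0 i].
have mhalf k : measurable (half k).
  rewrite (_ : half k = rV_coord i @^-1` `[k, +oo[%classic).
    by rewrite -[X in measurable X]setTI; exact: measurable_rV_coord.
  by apply/seteqP; split => x; rewrite /half /= in_itv/= andbT.
pose F (j : nat) := A `&` half j%:R.
have mF j : measurable (F j) by exact: measurableI.
have F0 : mu (F j) @[j --> \oo] --> 0%E.
  have -> : 0%E = mu (\bigcap_j F j).
    rewrite (_ : \bigcap_j F j = set0) ?measure0// -subset0 => x Fx.
    have [_] := Fx (Num.bound (x ord0 i)) I.
    rewrite /half /= leNgt; apply/negP; rewrite negbK.
    have [x0|x0] := leP 0 (x ord0 i); first exact: archi_boundP.
    exact: lt_le_trans x0 _.
  apply: nonincreasing_cvg_mu => //.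
  - apply: le_lt_trans Afin; apply: le_measure; rewrite ?inE//; exact: subIsetl.
  - exact: bigcap_measurable.
  - move=> j k jk; apply/subsetPset => x [Ax /= kx]; split => //=.
    by apply: le_trans kx; rewrite ler_nat.
have AE (K j : nat) : (0 < K)%N -> mu (A `&` half (- K%:R)) = mu (F j).
  move=> K0; pose h : R := K%:R + j%:R.
  have h0 : 0 < h by rewrite ltr_wpDr// ltr0n.
  rewrite -(lebesgue_rV_translation (h *: basisv i) (F j))//.
  have mT : measurable ((fun x => x + h *: basisv i) @^-1` F j).
    by rewrite -[X in measurable X]setTI; apply: measurable_rV_translation.
  have [N [mN N0 HN]] := fsh h h0.
  have xi x : (x + h *: basisv i) ord0 i = x ord0 i + h.
    by rewrite !mxE !eqxx /= mulr1.
  have EN : A `&` half (- K%:R) `\` N = (fun x => x + h *: basisv i) @^-1` F j `\` N.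
    apply/seteqP; split => x [[Ax hx] Nx]; split => //;
      have fx : f (x + h *: basisv i) = f x by apply: contrapT => /HN.
      split; rewrite /A /half /= ?fx ?xi//.
      by move: hx; rewrite /half /= /h; lra.
    split; first by move: Ax; rewrite /A /= fx.
    by move: hx; rewrite /half /= xi /h; lra.
  have DN B : measurable B -> mu (B `\` N) = mu B.
    move=> mB.
    have -> : mu B = (mu (B `\` N) + mu (B `&` N))%E by exact: measureDI.
    rewrite (_ : mu (B `&` N) = 0%E) ?adde0//.
    by apply: subset_measure0 N0 => //; exact: measurableI.
  by rewrite -(DN (A `&` half _)) ?EN ?DN//; exact: measurableI.
have A0 (K : nat) : (0 < K)%N -> mu (A `&` half (- K%:R)) = 0%E.
  move=> K0; apply: (@cvg_unique _ _ _ _ _ _ _ F0) => //.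
  rewrite (_ : (fun j => mu (F j)) = fun=> mu (A `&` half (- K%:R))); first exact:
      cvg_cst.
  by apply/funext => j; exact/esym/AE.
have : mu.-negligible (\bigcup_K (A `&` half (- K.+1%:R))).
  apply: negligible_bigcup => K; exists (A `&` half (- K.+1%:R)); split => //.
    exact: measurableI.
  exact: A0.
apply: negligibleS => x Ax.
exists (Num.bound (`|x ord0 i|)) => //; split => //=.
have h1 : `|x ord0 i| < (Num.bound (`|x ord0 i|))%:R by exact: archi_boundP.
have := lerNnormlW (lexx `|x ord0 i|).
rewrite /half /= -natr1; lra.
Qed.

(** The hypotheses cover min (u, c) with s = 1 and max (u, c) with s = -1.
    Extremal levels are used twice: u - v is extremal where u = v, so the two
    gradients agree there, and v is extremal where v = c, so its gradient is
    zero there. *)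
Lemma energy_truncation p c s u v : 0 < p -> s != 0 ->
  locally_integrable_rV u -> locally_integrable_rV v ->
  weakly_differentiable u -> weakly_differentiable v ->
  mu.-integrable setT (fun x => (enorm (weak_gradient u x) `^ p)%:E) ->
  mu.-integrable setT (fun x => (enorm (weak_gradient v x) `^ p)%:E) ->
  (forall x, 0 <= s * (u x - v x)) -> (forall x, 0 <= - s * (v x - c)) ->
  (forall x, u x = v x \/ v x = c) ->
  (Jfun p v <= Jfun p u)%E /\
  ((Jfun p u <= Jfun p v)%E -> (0 < n)%N ->
   (forall a, 0 < a -> (mu [set x | (a < `|u x|)%R] < +oo)%E) ->
   (forall a, 0 < a -> (mu [set x | (a < `|v x|)%R] < +oo)%E) ->
   {ae mu, forall x, u x = v x}).
Proof.
move=> p0 s0 ui vi du dv eu ev uv vc uvc.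
have wu : is_weak_gradient u (weak_gradient u) by exact: xgetPex du.
have wv : is_weak_gradient v (weak_gradient v) by exact: xgetPex dv.
set gu := weak_gradient u in eu wu *; set gv := weak_gradient v in ev wv *.
have Wu i := weak_partial_of_gradient u gu i ui wu.
have Wv i := weak_partial_of_gradient v gv i vi wv.
have key : {ae mu, forall x, (u x = v x /\ gu x = gv x) \/ (v x = c /\ gv x = 0)}.
  have H i : {ae mu, forall x, (u x = v x -> gu x ord0 i = gv x ord0 i) /\
      (v x = c -> gv x ord0 i = 0)}.
    have uv0 x : 0 <= s * ((u \- v) x - 0) by rewrite /= subr0.
    have h1 := weak_partial_extremum i _ _ 0 s (weak_partialB _ _ _ _ _ (Wu i) (Wv i))
        s0 uv0.
    have h2 := weak_partial_extremum i _ _ c (- s) (Wv i).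
    rewrite oppr_eq0 in h2; have {}h2 := h2 s0 vc.
    apply: filterS2 h1 h2.
    move=> x h1x h2x; split => // uvx; apply/eqP; rewrite -subr_eq0; apply/eqP.
    by apply: h1x; rewrite /= uvx subrr.
  apply: filterS (filter_forall _ H) => x Hx.
  have [uvx|vcx] := uvc x; [left|right]; split => //; apply/rowP => i.
    exact: (Hx i).1.
  by rewrite mxE; exact: (Hx i).2.
have enorm_eq0 (x : 'rV[R]_n) : enorm x = 0 -> x = 0.
  move=> /eqP; rewrite sqrtr_eq0 => x0.
  have : dotv x x = 0.
    by apply/eqP; rewrite eq_le x0 sumr_ge0// => i _; rewrite -expr2 sqr_ge0.
  move=> /eqP; rewrite psumr_eq0; last by move=> i _; rewrite -expr2 sqr_ge0.
  move=> /allP h; apply/rowP => i; have := h i (mem_index_enum _).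
  by rewrite mxE mulf_eq0 orbb => /eqP.
have enorm0 : enorm (0 : 'rV[R]_n) = 0.
  by rewrite /enorm /dotv big1 ?sqrtr0// => i _; rewrite mxE mul0r.
have le_ae : {ae mu, forall x, enorm (gv x) `^ p <= enorm (gu x) `^ p}.
  apply: filterS key => x [[_ ->]//|[_ ->]].
  by rewrite enorm0 powR0 ?powR_ge0// gt_eqF.
have mgu := measurable_int _ eu; have mgv := measurable_int _ ev.
have Jle : (\int[mu]_x (enorm (gv x) `^ p)%:E <= \int[mu]_x (enorm (gu x) `^ p)%:E)%E.
  apply: ae_ge0_le_integral.
  - exact: measurableT.
  - by move=> x _; rewrite lee_fin powR_ge0.
  - exact: mgv.
  - by move=> x _; rewrite lee_fin powR_ge0.
  - exact: mgu.
  - by apply: filterS le_ae => x h _; rewrite lee_fin.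
split; first by rewrite /Jfun lee_wpmul2l// lee_fin invr_ge0 ltW.
move=> Juv n0 ulev vlev.
have int_eq : (\int[mu]_x (enorm (gu x) `^ p)%:E <= \int[mu]_x (enorm (gv x) `^ p)%:E)%E.
  by move: Juv; rewrite /Jfun lee_pmul2l// lte_fin invr_gt0.
have diff0 : {ae mu, forall x, enorm (gu x) `^ p = enorm (gv x) `^ p}.
  exact: (ae_eq_le_integral _ _ _ _ _ _ eu ev le_ae int_eq).
have W0 i : weak_partial i (u \- v) (fun=> 0).
  apply: (weak_partial_ae _ _ _ _ (weak_partialB _ _ _ _ _ (Wu i) (Wv i))).
    split => // k; apply: eq_integrable (integrable0 _ _) => //.
    exact: measurable_box.
  apply: filterS2 key diff0 => x /= [[_ ->]|[_ ->]] d; first by rewrite subrr.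
  have : enorm (gu x) = 0.
    have /eqP : enorm (gu x) `^ p = 0 by rewrite d enorm0 powR0// gt_eqF.
    by rewrite powR_eq0 => /andP[/eqP].
  by move=> /enorm_eq0 ->; rewrite mxE subrr.
have [mu1 mv1] := (ui.1, vi.1).
have : {ae mu, forall x, (u \- v) x = 0}.
  apply: (translation_invariant_eq0 (Ordinal n0)).
  - exact: measurable_funB.
  - move=> a a0; have a20 : 0 < a / 2 by lra.
    have m1 := measurable_levels u (a / 2) mu1; have m2 := measurable_levels v (a / 2)
        mv1.
    apply: (@le_lt_trans _ _ (mu ([set x | a / 2 < `|u x|] `|` [set x | a / 2 < `|v
        x|]))).
      apply: le_measure; rewrite ?inE.
      + by apply: measurable_levels; exact: measurable_funB.
      + exact: measurableU.
      + move=> x /= ax; have [ux|ux] := ltP (a / 2) `|u x|; [by left|right].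
        have := ler_normB (u x) (v x); lra.
    apply: le_lt_trans (measureU2 _ m1 m2) _.
    by rewrite lte_add_pinfty// ?ulev ?vlev.
  - move=> h h0; exact: weak_partial0_translation.
by apply: filterS => x /= /eqP; rewrite subr_eq0 => /eqP.
Qed.

End truncation_energy.

(** * Potential of truncations *)
Section truncation_potential.
Context d (T : measurableType d) (R : realType) (mu : {measure set T -> \bar R}).
Variables (v : T -> R) (G : R -> R) (eps : R).
Hypothesis mv : measurable_fun setT v.
Hypothesis v0 : forall x, 0 <= v x.
Hypothesis vlev : forall a, 0 < a -> (mu [set x | (a < v x)%R] < +oo)%E.
Hypothesis cG : continuous G.
Hypothesis eps0 : 0 < eps.
Hypothesis Geps : forall s, 0 <= s <= eps -> G s <= 0.
Hypothesis Gi : mu.-integrable setT (fun x => (G (v x))%:E).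

Let A (t : R) : set T := [set x | t < v x].

Let mA t : measurable (A t).
Proof.
rewrite (_ : A t = v @^-1` `]t, +oo[%classic).
  by rewrite -[X in measurable X]setTI; exact: mv.
by apply/seteqP; split => x; rewrite /A /= in_itv/= andbT.
Qed.

Let mGmin t : measurable_fun setT (fun x => G (Num.min (v x) t)).
Proof.
apply: measurableT_comp; first exact: continuous_measurable_fun.
exact: measurable_minr.
Qed.

(** A bound for G (min (v, t)) that is uniform in t >= a as long as M bounds G on
    the range of t. *)
Let dominant a M x : R := `|G (v x)| + M * \1_(A a) x.

Let integrable_dominant a M : 0 < a -> mu.-integrable setT (EFin \o dominant a M).
Proof.
move=> a0; rewrite (_ : EFin \o _ = (fun x => `|G (v x)|%:E) \+ (fun x => M%:E * (\1_(A
    a) x)%:E))%E //.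
apply: integrableD => //; first exact: (integrable_norm Gi).
apply: integrableZl => //; apply/integrableP; split.
  by apply/measurable_EFinP; exact: measurable_indic.
under eq_integral do rewrite /= ger0_norm//.
by rewrite integral_indic// setIT vlev.
Qed.

Let Gmin_le a b t M x : 0 < a -> a <= t <= b -> (forall s, 0 <= s <= b -> `|G s| <= M) ->
  `|G (Num.min (v x) t)| <= dominant a M x.
Proof.
move=> a0 /andP[at_ tb] GM; rewrite /dominant indicE.
have M0 : 0 <= v x <= b -> 0 <= M by move=> h; apply: le_trans (GM _ h); exact: normr_ge0.
have [xt|tx] := leP (v x) t.
  rewrite lerDl; case: (x \in _); rewrite ?mulr0 ?mulr1//.
  by apply: M0; rewrite v0 (le_trans xt).
rewrite mem_set /A /=; last exact: le_lt_trans tx.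
rewrite mulr1 ler_wpDl//; apply: GM.
by rewrite tb (le_trans (ltW a0)).
Qed.

Let G_bounded b : exists M, forall s, 0 <= s <= b -> `|G s| <= M.
Proof.
have [b0|b0] := leP 0 b; last first.
  by exists 0 => s /andP[s0 sb]; have := lt_le_trans (le_lt_trans sb b0) s0; rewrite ltxx.
have [c _ Hc] := EVT_max b0 (continuous_subspaceT (fun x => @cvg_norm _ _ _ _ _ _ _ (cG
    x))).
by exists `|G c| => s sb; apply: Hc; rewrite in_itv.
Qed.

Let integrable_Gmin t : 0 < t -> mu.-integrable setT (fun x => (G (Num.min (v x) t))%:E).
Proof.
move=> t0; have [M HM] := G_bounded t.
apply: le_integrable (integrable_dominant t M t0) => //.
  exact/measurable_EFinP.
move=> x _; rewrite /= lee_fin; apply: le_trans (ler_norm _).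
by apply: (Gmin_le t t) => //; rewrite lexx.
Qed.

Let psi t := \int[mu]_x G (Num.min (v x) t).

Let continuous_psi b : {within `[eps, b], continuous psi}.
Proof.
(* continuity on [eps, b] is read off the open interval ]eps / 2, b + 1[ *)
have [M HM] := G_bounded (b + 1).
have e2 : 0 < eps / 2 by rewrite divr_gt0.
have := @continuity_under_integral R d T mu (fun t x => G (Num.min (v x) t)) setT
    measurableT
  (eps / 2) (b + 1) _ _ (dominant (eps / 2) M) (integrable_dominant _ _ e2) _.
move=> H.
apply: continuous_in_subspaceT => t; rewrite inE/= in_itv/= => /andP[et tb].
apply: H; last by rewrite inE/= in_itv/=; apply/andP; split; lra.
- move=> s; rewrite /= in_itv/= => /andP[es sb]; apply: integrable_Gmin; lra.
- apply: aeW => x _ s _; apply: (@continuous_comp _ _ _ (fun s => Num.min (v x) s) G).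
    by apply: continuous_min; [exact: cst_continuous|exact: id].
  exact: cG.
- move=> s; rewrite /= in_itv/= => /andP[es sb].
  apply: aeW => x _; apply: (Gmin_le _ (b + 1)) => //; lra.
Qed.

Let psi_eps : psi eps <= 0.
Proof.
apply: (@le_trans _ _ (\int[mu]_(x in setT) (0 : R))); last first.
  by rewrite Rintegral_cst// mul0r.
apply: le_Rintegral => //; first exact: integrable_Gmin.
  exact: integrable0.
move=> x _; apply: Geps; rewrite ge_min lexx orbT andbT le_min v0/=.
exact: ltW.
Qed.

(** Suppose psi < 0 on [eps, +oo[ and let c = V / 2, where V > 0 is the integral
    of G (v). With m t the measure of {t < v}, for t beyond some tau the tail of
    |G (v)| is less than c, and psi t < 0 gives G t * m t < - c. As m is
    nonincreasing, |G (v)| >= c / m tau on {tau < v}, whose integral over this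
    set is at least c: a contradiction. *)
Let psi_ge0 : (0 < \int[mu]_x (G (v x))%:E)%E -> exists2 t, eps <= t & 0 <= psi t.
Proof.
move=> V0; apply: contrapT => /forall2NP Hneg.
have psi_lt0 t : eps <= t -> psi t < 0.
  by move=> et; have [//|/negP] := Hneg t; rewrite -ltNge.
have Vfin := integrable_fin_num measurableT Gi.
set V := fine (\int[mu]_x (G (v x))%:E).
have VE : (\int[mu]_x (G (v x))%:E)%E = V%:E by rewrite fineK.
have {}V0 : 0 < V by rewrite -lte_fin -VE.
pose absG x := `|G (v x)|.
have absGi : mu.-integrable setT (EFin \o absG) by exact: (integrable_norm Gi).
have mG : measurable_fun setT (fun x => G (v x)).
  by apply/measurable_EFinP; exact: measurable_int Gi.
have tail : (\int[mu]_(x in A k%:R) (absG x)%:E)%E @[k --> \oo] --> 0%E.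
  rewrite (_ : (fun k => _) = (fun k => \int[mu]_x ((absG x * \1_(A k%:R) x)%:E)))%E;
      last first.
    apply/funext => k; rewrite integral_mkcond; apply: eq_integral => x _.
    by rewrite patchE indicE; case: ifP => _; rewrite ?mulr1 ?mulr0.
  rewrite -[X in _ --> X](integral0 mu setT).
  apply: (@dominated_cvg _ _ _ mu _ measurableT
    (fun k x => (absG x * \1_(A k%:R) x)%:E) (cst 0%E) (EFin \o absG)) => //.
  - move=> k; apply/measurable_EFinP; apply: measurable_funM.
      exact: measurableT_comp.
    exact: measurable_indic.
  - move=> x _; apply: cvg_near_cst; near=> k.
    rewrite indicE memNset ?mulr0// /A /=; apply/negP; rewrite -leNgt.
    by near: k; exact: nbhs_infty_ger.
  - move=> k x _; rewrite /= lee_fin ger0_norm; last by apply: mulr_ge0; rewrite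
      ?normr_ge0.
    by rewrite ler_piMr// normr_ge0.
have [k0 tailk] : exists k0 : nat, forall k, (k0 <= k)%N ->
    (\int[mu]_(x in A k%:R) (absG x)%:E < (V / 2)%:E)%E.
  have V2 : (0 < (V / 2)%:E)%E by rewrite lte_fin divr_gt0.
  have [k0 _ Hk] : \forall k \near \oo, (\int[mu]_(x in A k%:R) (absG x)%:E < (V /
      2)%:E)%E.
    exact: tail (open_ereal_lt' V2).
  by exists k0 => k; exact: Hk.
pose tau : R := (maxn k0 (Num.bound eps))%:R.
have etau : eps <= tau.
  apply: (@le_trans _ _ (Num.bound eps)%:R); first exact/ltW/archi_boundP/ltW.
  by rewrite ler_nat leq_maxr.
have tau0 : 0 < tau by exact: lt_le_trans etau.
have tailtau : \int[mu]_(x in A tau) absG x < V / 2.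
  rewrite -lte_fin /Rintegral fineK; first by apply: tailk; exact: leq_maxl.
  by apply: integrable_fin_num => //; exact: integrableS absGi.
pose m t := fine (mu (A t)).
have mE t : 0 < t -> mu (A t) = (m t)%:E.
  by move=> t0; rewrite fineK// ge0_fin_numE// vlev.
have indE t f : \int[mu]_(x in A t) f x = \int[mu]_x (f x * \1_(A t) x).
  rewrite Rintegral_mkcond; apply: eq_Rintegral => x _.
  by rewrite patchE indicE; case: ifP => _; rewrite ?mulr1 ?mulr0.
have ind_int t : 0 < t -> mu.-integrable setT (EFin \o (\1_(A t) : T -> R)).
  move=> t0; apply/integrableP; split.
    by apply/measurable_EFinP; exact: measurable_indic.
  under eq_integral do rewrite /= ger0_norm//.
  by rewrite integral_indic// setIT vlev.
have Gm t : tau <= t -> G t * m t < - (V / 2).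
  move=> tt; have t0 := lt_le_trans tau0 tt.
  have absGt : mu.-integrable setT (EFin \o (fun x => absG x * \1_(A t) x)).
    apply: le_integrable absGi => //.
      apply/measurable_EFinP; apply: measurable_funM; last exact: measurable_indic.
      exact: measurableT_comp.
    move=> x _; rewrite /= lee_fin normrM ler_piMr// indicE.
    by case: (_ \in _); rewrite ?normr1 ?normr0.
  have cind : mu.-integrable setT (EFin \o (fun x => G t * \1_(A t) x)).
    exact: (integrableZl measurableT (G t) (ind_int t t0)).
  have d1 : mu.-integrable setT (EFin \o (fun x => G (v x) - absG x * \1_(A t) x)).
    exact: (integrableB measurableT Gi absGt).
  have : \int[mu]_x (G (v x) - absG x * \1_(A t) x + G t * \1_(A t) x) <= psi t.
    apply: le_Rintegral => //.
    - exact: (integrableD measurableT d1 cind).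
    - exact: integrable_Gmin.
    - move=> x _; rewrite indicE; have [xt|tx] := leP (v x) t.
        by rewrite memNset ?mulr0 ?subr0 ?addr0//= /A /=; apply/negP; rewrite -leNgt.
      rewrite mem_set//= !mulr1 gerDr /absG subr_le0; exact: ler_norm.
  rewrite RintegralD// RintegralB// RintegralZl//; last exact: ind_int.
  rewrite -[X in _ - X]indE.
  have -> : \int[mu]_x \1_(A t) x = m t by rewrite /Rintegral integral_indic// setIT.
  have -> : \int[mu]_x G (v x) = V by [].
  have : \int[mu]_(x in A t) absG x <= \int[mu]_(x in A tau) absG x.
    rewrite -lee_fin /Rintegral !fineK.
    + apply: ge0_subset_integral => //.
        by apply/measurable_EFinP; apply: measurable_funTS; exact: measurableT_comp.
      by move=> x _; rewrite lee_fin normr_ge0.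
      by move=> x; rewrite /A /=; exact: le_lt_trans tt.
    + by apply: integrable_fin_num => //; exact: integrableS absGi.
    + by apply: integrable_fin_num => //; exact: integrableS absGi.
  have := psi_lt0 t (le_trans etau tt); lra.
have m_ge0 t : 0 <= m t by rewrite /m fine_ge0.
have mtau : 0 < m tau.
  rewrite lt_neqAle m_ge0 andbT; apply/eqP => m0.
  by have := Gm tau (lexx _); rewrite -m0 mulr0; lra.
have Gbig x : A tau x -> V / 2 / m tau <= absG x.
  rewrite /A /= => xt; rewrite ler_pdivrMr//.
  have mle : m (v x) <= m tau.
    rewrite -lee_fin -!mE//; last exact: lt_trans xt.
    apply: le_measure; rewrite ?inE//; move=> y; rewrite /A /=; exact: lt_trans.
  have h1 := Gm _ (ltW xt).
  have h2 : absG x * m (v x) <= absG x * m tau by rewrite ler_wpM2l ?normr_ge0.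
  have h3 : - (G (v x) * m (v x)) <= absG x * m (v x).
    by rewrite -mulNr ler_wpM2r ?m_ge0// /absG -normrN ler_norm.
  lra.
have : V / 2 <= \int[mu]_(x in A tau) absG x.
  have -> : V / 2 = \int[mu]_(x in A tau) (V / 2 / m tau).
    by rewrite Rintegral_cst// -/(m tau) divfK// gt_eqF.
  apply: le_Rintegral => //; last exact: integrableS absGi.
  apply/integrableP; split; first exact: measurable_cst.
  by rewrite integral_cst// lte_mul_pinfty// mE// ltry.
lra.
Unshelve. all: by end_near. Qed.

Lemma exists_truncation_potential_eq0 : (0 < \int[mu]_x (G (v x))%:E)%E ->
  exists2 t, 0 < t & (\int[mu]_x (G (Num.min (v x) t))%:E = 0)%E.
Proof.
move=> /psi_ge0[b eb psib].
have [|t] := @IVT R psi eps b 0 eb (continuous_psi b).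
  by rewrite ge_min le_max psi_eps psib orbT.
rewrite in_itv/= => /andP[et _] psit; have t0 := lt_le_trans eps0 et.
exists t => //; rewrite -[RHS](_ : (psi t)%:E = _); last by rewrite psit.
by rewrite /psi /Rintegral fineK//; exact: integrable_fin_num (integrable_Gmin t t0).
Qed.

End truncation_potential.

(** * The minimization problems *)
Section minimizers.
Context {R : realType} {n : nat}.
Local Notation mu := (@lebesgue_rV R n).
Implicit Types u v w : 'rV[R]_n -> R.

Lemma nonzero_potential (G : R -> R) u : G 0 = 0 ->
  measurable_fun setT (fun x => (G (u x))%:E) -> Vfun G u != 0%E -> nonzero_ae u.
Proof.
move=> G0 mGu /eqP V0 u0; apply: V0; rewrite /Vfun.
rewrite (ae_eq_integral (cst 0%E))//; first by rewrite integral0.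
by apply: filterS u0 => x /= -> _; rewrite G0.
Qed.

Variables (p : R) (G : R -> R) (X : set ('rV[R]_n -> R)) (eps : R).
Hypothesis p0 : 0 < p.
Hypothesis n0 : (0 < n)%N.
Hypothesis cG : continuous G.
Hypothesis eps0 : 0 < eps.
Hypothesis Geps : forall s : R, (- eps <= s < 0) || (0 < s <= eps) -> G s < 0.
Hypothesis Xloc : forall u, X u -> locally_integrable_rV u.
Hypothesis Xlev : forall u (a : R), X u -> 0 < a -> (mu [set x | (a < `|u x|)%R] < +oo)%E.
Hypothesis Xweak : forall u, X u -> weakly_differentiable u.
Hypothesis Xgrad : forall u, X u -> mu.-integrable setT
    (fun x => (enorm (weak_gradient u x) `^ p)%:E).
Hypothesis XG : forall u, X u -> mu.-integrable setT (fun x => (G (u x))%:E).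
Hypothesis Xmin : forall u (t : R), X u -> 0 <= t -> X (fun x => Num.min (u x) t).
Hypothesis Xmax : forall u (s : R), X u -> s <= 0 -> X (fun x => Num.max (u x) s).

Let J := @Jfun R n p.
Let V := @Vfun R n G.

(** Otherwise |G (u)| >= |G 0| / 2 where |u| is small, that is outside a set of
    finite measure, and G (u) would not be integrable. *)
Lemma potential_at_0 u : X u -> G 0 = 0.
Proof.
move=> Xu; apply: contrapT => /eqP G00.
have a0 : 0 < `|G 0| / 2 by rewrite divr_gt0// normr_gt0.
have [e /= e0 He] : \forall s \near (0 : R), `|G 0| / 2 < `|G s|.
  apply: (cvgr_gt _ (@cvg_norm _ _ _ _ _ _ _ (cG 0))).
  by rewrite ltr_pdivrMr// ltr_pMr ?normr_gt0// ltr1n.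
have m1 : measurable [set x | e / 2 < `|u x|] by apply: measurable_levels; exact: (Xloc
    _ Xu).1.
have := Xlev u (e / 2) Xu (divr_gt0 e0 (ltr0Sn _ 1)) => L1.
have mG := measurable_int _ (XG u Xu).
have L2 : ((`|G 0| / 2)%:E * mu [set x | ((`|G 0| / 2)%:E <= `|(G (u x))%:E|)%E] <=
    \int[mu]_x `|(G (u x))%:E|)%E.
  by have := le_integral_abse mu measurableT mG a0; rewrite setTI.
have m2 : measurable [set x | ((`|G 0| / 2)%:E <= `|(G (u x))%:E|)%E].
  by rewrite -[X in measurable X]setTI; apply: emeasurable_fun_c_infty => //; exact:
      measurableT_comp.
have L3 : (mu [set x | ((`|G 0| / 2)%:E <= `|(G (u x))%:E|)%E] < +oo)%E.
  have /integrableP[_ fin] := XG u Xu.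
  rewrite ltey; apply/eqP => mo; move: L2; rewrite mo gt0_muley ?lte_fin// leye_eq =>
      /eqP E.
  by rewrite E ltxx in fin.
have : (mu [set: 'rV[R]_n] < +oo)%E.
  apply: le_lt_trans (lte_add_pinfty L1 L3).
  apply: le_trans (measureU2 _ m1 m2).
  apply: le_measure; rewrite ?inE//; first exact: measurableU.
  move=> x _; have [ux|ux] := ltP (e / 2) `|u x|; [by left|right].
  rewrite /= lee_fin; apply/ltW/He; rewrite /= sub0r normrN; lra.
by rewrite lebesgue_rV_setT.
Qed.

Lemma energy_min u (t : R) : X u -> 0 <= t -> let v := fun x => Num.min (u x) t in
  (J v <= J u)%E /\ ((J u <= J v)%E -> {ae mu, forall x, u x = v x}).
Proof.
move=> Xu t0 v; have Xv : X v by exact: Xmin.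
have [|||h1 h2] := energy_truncation p t 1 u v p0 (oner_neq0 _) (Xloc _ Xu) (Xloc _ Xv)
  (Xweak _ Xu) (Xweak _ Xv) (Xgrad _ Xu) (Xgrad _ Xv).
- by move=> x; rewrite mul1r subr_ge0 ge_min lexx.
- by move=> x; rewrite mulN1r oppr_ge0 subr_le0 ge_min lexx orbT.
- by move=> x; rewrite /v; case: leP; [left|right].
split => // Juv; apply: h2 => // a a0; exact: Xlev.
Qed.

Lemma energy_max u (t : R) : X u -> t <= 0 -> let v := fun x => Num.max (u x) t in
  (J v <= J u)%E /\ ((J u <= J v)%E -> {ae mu, forall x, u x = v x}).
Proof.
move=> Xu t0 v; have Xv : X v by exact: Xmax.
have N1 : - 1 != 0 :> R by rewrite oppr_eq0 oner_neq0.
have [|||h1 h2] := energy_truncation p t (- 1) u v p0 N1 (Xloc _ Xu) (Xloc _ Xv)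
  (Xweak _ Xu) (Xweak _ Xv) (Xgrad _ Xu) (Xgrad _ Xv).
- by move=> x; rewrite mulN1r oppr_ge0 subr_le0 le_max lexx.
- by move=> x; rewrite opprK mul1r subr_ge0 le_max lexx orbT.
- by move=> x; rewrite /v; case: leP; [right|left].
split => // Juv; apply: h2 => // a a0; exact: Xlev.
Qed.

Lemma potential_fin_num u : X u -> V u \is a fin_num.
Proof. by move=> Xu; exact: integrable_fin_num (XG u Xu). Qed.

Lemma potential_posneg u : X u ->
  V u = (V (fun x => Num.max (u x) 0%R) + V (fun x => Num.min (u x) 0%R))%E.
Proof.
move=> Xu; rewrite /V /Vfun -integralD//; last 2 first.
- exact: XG (Xmax _ _ Xu (lexx _)).
- exact: XG (Xmin _ _ Xu (lexx _)).
apply: eq_integral => x _; rewrite -EFinD; congr EFin.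
by case: leP => _; rewrite (potential_at_0 u Xu) ?add0r ?addr0.
Qed.

Lemma nonzero_of_potential u : X u -> V u != 0%E -> nonzero_ae u.
Proof.
by move=> Xu; apply: nonzero_potential; [exact: potential_at_0 Xu|exact: measurable_int
    (XG u Xu)].
Qed.

(** The negative part is treated by applying [exists_truncation_potential_eq0]
    to - u- and G (- s). *)
Lemma truncate_potential u : X u -> (0 < V u)%E -> exists w,
  [/\ X w, nonzero_ae w, V w = 0%E, (J w <= J u)%E &
      (J u <= J w)%E -> {ae mu, forall x, u x = w x}].
Proof.
move=> Xu Vu; have G0 := potential_at_0 u Xu.
pose up x := Num.max (u x) 0; pose un x := Num.min (u x) 0.
have Xup : X up by exact: Xmax. have Xun : X un by exact: Xmin.
have [J1 J1e] := energy_max u 0 Xu (lexx _); have [J2 J2e] := energy_min u 0 Xu (lexx _).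
have Gle s : - eps <= s <= eps -> G s <= 0.
  move=> /andP[s1 s2]; have [s0|s0|->] := ltgtP s 0; last by rewrite G0.
    by apply/ltW/Geps; rewrite s1 s0.
  by apply/ltW/Geps; rewrite s2 s0 orbT.
have [Vup|Vup] := ltP 0%E (V up).
  have up0 x : 0 <= up x by rewrite le_max lexx orbT.
  have [||t t0 Vt] := @exists_truncation_potential_eq0 _ _ R mu up G eps (Xloc _ Xup).1
      up0 _ cG eps0 _ (XG _ Xup) Vup.
  - move=> a a0; have := Xlev up a Xup a0.
    by under eq_set do rewrite ger0_norm//.
  - by move=> s /andP[s0 se]; apply: Gle; rewrite se andbT; lra.
  have [J3 J3e] := energy_min up t Xup (ltW t0).
  exists (fun x => Num.min (up x) t); split.
  - exact: Xmin Xup (ltW t0).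
  - move=> w0; have : V up != 0%E by rewrite gt_eqF.
    move=> /(nonzero_of_potential _ Xup); apply; apply: filterS w0 => x.
    by case: leP => // _ t00; rewrite t00 ltxx in t0.
  - exact: Vt.
  - exact: le_trans J3 J1.
  - move=> Juw; have /J1e h1 := le_trans Juw J3; have /J3e h3 := le_trans J1 Juw.
    by apply: filterS2 h1 h3 => x -> <-.
have Vun : (0 < V un)%E.
  move: Vu; rewrite (potential_posneg u Xu) -/up -/un => Vu; rewrite ltNge; apply/negP
      => Vun.
  by move: Vu; rewrite ltNge; apply/negP; rewrite negbK; exact: adde_le0.
have un0 x : 0 <= - un x by rewrite oppr_ge0 ge_min lexx orbT.
have E x t : Num.max (un x) (- t) = - Num.min (- un x) t.
  by rewrite oppr_min opprK.
have [||||||t t0 Vt] := @exists_truncation_potential_eq0 _ _ R mu (fun x => - un x)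
    (fun s => G (- s)) eps _ un0 _ _ eps0 _.
- by apply: measurableT_comp => //; exact: (Xloc _ Xun).1.
- move=> a a0; have := Xlev un a Xun a0.
  by under eq_set do rewrite -normrN ger0_norm//.
- by move=> s; apply: (@continuous_comp _ _ _ -%R G); [exact: opp_continuous|exact: cG].
- by move=> s /andP[s0 se]; apply: Gle; apply/andP; split; lra.
- by have := XG _ Xun; under eq_fun do rewrite -[un _]opprK.
- have E0 : (\int[mu]_x (G (- - un x))%:E)%E = V un.
    by apply: eq_integral => x _; rewrite opprK.
  by rewrite E0.
have t0' : - t <= 0 by rewrite oppr_le0 ltW.
have [J3 J3e] := energy_max un (- t) Xun t0'.
exists (fun x => Num.max (un x) (- t)); split.
- exact: Xmax Xun t0'.
- move=> w0; have : V un != 0%E by rewrite gt_eqF.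
  move=> /(nonzero_of_potential _ Xun); apply; apply: filterS w0 => x.
  by case: leP => // _ t00; move: t0'; have := t0; rewrite -oppr_lt0 t00 ltxx.
- by rewrite /V /Vfun; under eq_integral do rewrite E.
- exact: le_trans J3 J2.
- move=> Juw; have /J2e h1 := le_trans Juw J3; have /J3e h3 := le_trans J2 Juw.
  by apply: filterS2 h1 h3 => x -> <-.
Qed.

Lemma minimizer_potential_ge0 u :
  minimizer J [set v | [/\ X v, nonzero_ae v & V v = 0%E]] u <->
  minimizer J [set v | [/\ X v, nonzero_ae v & (0 <= V v)%E]] u.
Proof.
split=> [[[Xu u0 Vu] umin]|[[Xu u0 Vu] umin]].
  split; first by split; rewrite ?Vu.
  move=> v [Xv v0]; rewrite le_eqVlt => /predU1P[/esym Vv|Vv]; first exact: umin.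
  have [w [Xw w0 Vw Jw _]] := truncate_potential v Xv Vv.
  by apply: le_trans Jw; exact: umin.
split; last by move=> v [Xv v0 Vv]; apply: umin; split; rewrite ?Vv.
split => //; apply/eqP; rewrite eq_le Vu andbT leNgt; apply/negP => Vu0.
have [w [Xw w0 Vw Jw Jwe]] := truncate_potential u Xu Vu0.
have /Jwe uw : (J u <= J w)%E by apply: umin; split; rewrite ?Vw.
suff E : V u = V w by rewrite E Vw ltxx in Vu0.
apply: ae_eq_integral => //; first exact: measurable_int (XG _ Xu).
  exact: measurable_int (XG _ Xw).
by apply: filterS uw => x -> _.
Qed.

(** Either u+ vanishes, or u+ is a competitor, or V u+ < 0 and then u- is a
    competitor with V u- > 0. A competitor among the two equals u. *)
Lemma minimizer_no_sign_change u :
  minimizer J [set v | [/\ X v, nonzero_ae v & (0 <= V v)%E]] u -> no_sign_change u.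
Proof.
move=> [[Xu u0 Vu] umin].
pose up x := Num.max (u x) 0; pose un x := Num.min (u x) 0.
have Xup : X up by exact: Xmax. have Xun : X un by exact: Xmin.
have [_ Jup] := energy_max u 0 Xu (lexx _); have [_ Jun] := energy_min u 0 Xu (lexx _).
have [up0|up0] := pselect (nonzero_ae up); last first.
  right; move/contrapT : up0; apply: filterS => x; rewrite /up.
  by case: leP => // ux ux0; rewrite ux0 ltxx in ux.
have [Vup|Vup] := leP 0%E (V up).
  left; have /Jup : (J u <= J up)%E by exact: umin.
  by apply: filterS => x /= ->; rewrite /up le_max lexx orbT.
right; have Vun : (0 < V un)%E.
  move: Vu; rewrite (potential_posneg u Xu) -/up -/un => Vu; rewrite ltNge; apply/negP
      => Vun.
  move: Vu; rewrite leNgt => /negP; apply.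
  by rewrite -(adde0 0%E); apply: lte_leD Vup Vun; exact: potential_fin_num.
have un0 : nonzero_ae un by apply: nonzero_of_potential => //; rewrite gt_eqF.
have /Jun : (J u <= J un)%E by apply: umin; split => //; exact: ltW.
by apply: filterS => x /= ->; rewrite /un ge_min lexx orbT.
Qed.

End minimizers.

Theorem proposition6 (R : realType) (N : nat) (p : R) (g G : R -> R)
    (X : set ('rV[R]_N -> R))
    (hp : 1 < p) (hpN : p = N%:R)
    (g0 : g 0 = 0)
    (G_cont : continuous G)
    (G_deriv : forall s : R, s != 0 -> is_derive s 1 G (g s))
    (g_cont : forall s : R, s != 0 -> {for s, continuous g})
    (X_adm : admissible p g G X)
    (X_min : forall u (t : R), X u -> 0 <= t -> X (fun x => Num.min (u x) t))
    (X_max : forall u (s : R), X u -> s <= 0 -> X (fun x => Num.max (u x) s)) :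
  let P0' := minimizer (Jfun p)
    [set v | [/\ X v, nonzero_ae v & Vfun G v = 0%E]] in
  let P0'' := minimizer (Jfun p)
    [set v | [/\ X v, nonzero_ae v & (0 <= Vfun G v)%E]] in
  let P0''' := minimizer (Jfun p)
    [set v | [/\ X v, nonzero_ae v & (Vfun G v <= 0)%E]] in
  let T0 := ereal_inf
    [set Jfun p u | u in [set v | [/\ X v, nonzero_ae v & Vfun G v = 0%E]]] in
  (0 < T0)%E ->
  (exists u, P0' u) ->
  ((exists2 eps : R, 0 < eps &
      forall s : R, (- eps <= s < 0) || (0 < s <= eps) -> G s < 0) ->
    (forall u, X u -> (P0' u <-> P0'' u)) /\
    (forall u, P0'' u -> no_sign_change u)) /\
  ((exists2 eps : R, 0 < eps &
      forall s : R, (- eps <= s < 0) || (0 < s <= eps) -> 0 < G s) ->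
    (forall u, X u -> (P0' u <-> P0''' u)) /\
    (forall u, P0''' u -> no_sign_change u)).
Proof.
move=> P0' P0'' P0''' T0 _ _.
have p0 : 0 < p by exact: lt_trans ltr01 hp.
have n0 : (0 < N)%N by rewrite -(ltr0n R) -hpN.
have [_ Xloc Xlev _ Xweak Xgrad XG _ _] := X_adm.
split=> -[eps eps0 Geps].
  split=> [u _|u].
    exact: (minimizer_potential_ge0 p G X eps p0 n0 G_cont eps0 Geps Xloc Xlev Xweak
        Xgrad XG X_min X_max).
  exact: (minimizer_no_sign_change p G X p0 n0 G_cont Xloc Xlev Xweak Xgrad XG X_min
      X_max).
pose H s := - G s.
have H_cont : continuous H by move=> s; apply: cvgN; exact: G_cont.
have Heps s : (- eps <= s < 0) || (0 < s <= eps) -> H s < 0.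
  by move=> /Geps; rewrite oppr_lt0.
have XH u : X u -> (lebesgue_rV N).-integrable setT (fun x => (H (u x))%:E).
  by move=> Xu; have := integrableN (XG u Xu).
have VH u : X u -> Vfun H u = (- Vfun G u)%E.
  move=> Xu; rewrite /Vfun -integralN//; exact: integrable_add_def (XG u Xu).
have E0 : [set v | [/\ X v, nonzero_ae v & Vfun G v = 0%E]] =
    [set v | [/\ X v, nonzero_ae v & Vfun H v = 0%E]].
  apply/seteqP; split => v [Xv v0 Vv]; split => //; first by rewrite VH// Vv oppe0.
  by apply/eqP; rewrite -oppe_eq0 -VH// Vv.
have E1 : [set v | [/\ X v, nonzero_ae v & (Vfun G v <= 0)%E]] =
    [set v | [/\ X v, nonzero_ae v & (0 <= Vfun H v)%E]].
  by apply/seteqP; split => v [Xv v0]; rewrite ?VH// => Vv; split;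
    rewrite ?VH// ?oppe_ge0// -oppe_ge0.
rewrite /P0' /P0''' E0 E1.
split=> [u _|u].
  exact: (minimizer_potential_ge0 p H X eps p0 n0 H_cont eps0 Heps Xloc Xlev Xweak
      Xgrad XH X_min X_max).
exact: (minimizer_no_sign_change p H X p0 n0 H_cont Xloc Xlev Xweak Xgrad XH X_min X_max).
Qed.
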